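(* Let $\mathcal{M}$ be an episodic MDP with $S$ states, $A$ actions, horizon $H$ and random rewards in $[0,1]$ almost surely, and suppose episodes are collected by an adaptive learner. Let $\delta\in(0,1)$. With probability at least $1-\delta$, for any $t\ge t_0:=\inf\{t:n_h^t(s,a)\ge1,\ \forall(h,s,a)\}$ and any stochastic policy $\pi\in\Pi^S$, $$\big|\widehat{V}_1^{\pi,t}-V_1^\pi\big|\le\sqrt{\beta^{bpi}(t,\delta)\min\Big(\sum_{h,s,a}\frac{p_h^\pi(s,a)^2}{n_h^t(s,a)},\ \sum_{h,s,a}\frac{\widehat{p}_h^{\pi,t}(s,a)^2}{n_h^t(s,a)}\Big)}.$$ Moreover, for any $\widetilde{r}\in[0,1]^{SAH}$, $$\Big|\sum_{h,s,a}\big(\widehat{p}_h^{\pi,t}(s,a)-p_h^\pi(s,a)\big)\widetilde{r}_h(s,a)\Big|\le\sqrt{\beta^p(t,\delta)\sum_{h,s,a}\frac{p_h^\pi(s,a)^2}{n_h^t(s,a)}}.$$ Here $\beta^p(t,\delta):=4H^2\log(2/\delta)+24SAH^3\log(1+t)$ and $\beta^{bpi}(t,\delta):=16H^2\log(2/\delta)+96SAH^3\log(1+t)$. (Both inequalities hold on the same event of probability at least $1-\delta$, for all such $t$, $\pi$, $\widetilde r$.)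
   Context: $\mathcal{M}=(\mathcal{S},\mathcal{A},\{p_h\}_{h\in[H]},s_1,H)$ is a finite-horizon MDP. In each episode $t=1,2,\dots$ the learner plays a policy $\pi^t$, chosen based on past observations, starting from $s_1$, and observes $(s_h^t,a_h^t,s_{h+1}^t)$ and a reward in $[0,1]$ with conditional mean $r_h(s_h^t,a_h^t)$ at each stage $h\in[H]$, with $s_{h+1}^t\sim p_h(\cdot|s_h^t,a_h^t)$. Convention: at stage $h=1$ only the state $s_1$ is considered, i.e. triplets $(h,s,a)$ range over those with $s=s_1$ when $h=1$. $n_h^t(s,a)$ is the number of visits to $(s,a)$ at stage $h$ in the first $t$ episodes; $\widehat{p}_h^t(\cdot|s,a)$ and $\widehat{r}_h^t(s,a)$ are the empirical transition frequencies and empirical mean reward. $\Pi^S$ is the set of stochastic policies. $p_h^\pi(s,a)$ is the probability of visiting $(s,a)$ at stage $h$ when playing $\pi$ under transitions $p$, and $\widehat{p}_h^{\pi,t}(s,a)$ the same under $\widehat{p}^t$. $V_1^\pi=\sum_{h,s,a}p_h^\pi(s,a)r_h(s,a)$ and $\widehat{V}_1^{\pi,t}=\sum_{h,s,a}\widehat{p}_h^{\pi,t}(s,a)\widehat{r}_h^t(s,a)$. *)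

(* Defs.v *)
(* MathComp / MathComp-Analysis *)
From HB Require Import structures.
From mathcomp Require Import all_boot all_order all_algebra.
From mathcomp Require Import all_classical all_reals all_analysis.

Set Implicit Arguments.
Unset Strict Implicit.
Unset Printing Implicit Defensive.

Import Order.TTheory GRing.Theory Num.Theory.
Import numFieldNormedType.Exports.

Local Open Scope classical_set_scope.
Local Open Scope ring_scope.

(* Stages 1, ..., H are numbered 0, ..., H.-1, and stage H is where the terminal
   state s_{H+1} lives.  Families indexed by a stage have type nat -> _ and only
   their values at h < H matter. *)

Definition is_distr (R : realType) (X : finType) (f : X -> R) : Prop :=
  (forall x, 0 <= f x) /\ \sum_x f x = 1.

Record mdp (R : realType) (S A : finType) (H : nat) := MDP {
  trans : nat -> S -> A -> S -> R;
  mean_reward : nat -> S -> A -> R;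
  init : S;
  trans_distr : forall h s a, (h < H)%N -> is_distr (trans h s a) }.

Definition stochastic_policy (R : realType) (S A : finType) (H : nat)
    (pi : nat -> S -> A -> R) : Prop :=
  forall h s, (h < H)%N -> is_distr (pi h s).

(* At the first stage only the initial state is considered. *)
Definition stage_state (S : finType) (s1 : S) (h : nat) (s : S) : bool :=
  (h == 0)%N ==> (s == s1).

Definition triplet_sum (R : realType) (S A : finType) (H : nat) (s1 : S)
    (f : nat -> S -> A -> R) : R :=
  \sum_(h < H) \sum_(s : S | stage_state s1 h s) \sum_(a : A) f h s a.

Fixpoint state_prob (R : realType) (S A : finType) (s1 : S)
    (p : nat -> S -> A -> S -> R) (pi : nat -> S -> A -> R)
    (h : nat) (s : S) : R :=
  if h is h'.+1 then
    \sum_(u : S) \sum_(b : A) state_prob s1 p pi h' u * pi h' u b * p h' u b s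
  else (s == s1)%:R.

Definition visit_prob (R : realType) (S A : finType) (s1 : S)
    (p : nat -> S -> A -> S -> R) (pi : nat -> S -> A -> R)
    (h : nat) (s : S) (a : A) : R :=
  state_prob s1 p pi h s * pi h s a.

Definition value (R : realType) (S A : finType) (H : nat) (s1 : S)
    (p : nat -> S -> A -> S -> R) (r pi : nat -> S -> A -> R) : R :=
  triplet_sum H s1 (fun h s a => visit_prob s1 p pi h s a * r h s a).

Definition rv_measurable (T : Type) (R : realType)
    (G : set (set T)) (X : T -> R) : Prop :=
  preimage_set_system setT X measurable `<=` G.

(* Measurability with respect to the discrete sigma-algebra of a finite type. *)
Definition discrete_measurable (T : Type) (X : finType)
    (G : set (set T)) (x : T -> X) : Prop :=
  forall v, G (x @^-1` [set v]).

(* Y is a version of the conditional expectation E[X | G]. *)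
Definition cond_expectation (d : measure_display) (T : measurableType d)
    (R : realType) (P : probability T R) (G : set (set T)) (X Y : T -> R) : Prop :=
  [/\ P.-integrable setT (EFin \o X),
      rv_measurable G Y
    & forall E, G E ->
        (\int[P]_(w in E) (X w)%:E = \int[P]_(w in E) (Y w)%:E)%E].

(* Interaction of an adaptive learner with M; episodes are numbered from 0.
   info t h is the information available in episode t when the state of stage h
   has been observed and before the action is drawn (info t H: at the end of the
   episode); info_act t h additionally contains that action.  Both may be larger
   than what the observations generate, so the learner may randomize.  The reward
   and the next state need not be conditionally independent. *)
Record interaction (d : measure_display) (T : measurableType d) (R : realType)
    (P : probability T R) (S A : finType) (H : nat) (M : mdp R S A H) :=
  Interaction {
  state : nat -> nat -> T -> S;
  action : nat -> nat -> T -> A;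
  reward : nat -> nat -> T -> R;
  policy : nat -> T -> nat -> S -> A -> R;
  info : nat -> nat -> set (set T);
  info_act : nat -> nat -> set (set T);
  info_sigma : forall t h, (h <= H)%N ->
    sigma_algebra setT (info t h) /\ info t h `<=` measurable;
  info_act_sigma : forall t h, (h < H)%N ->
    sigma_algebra setT (info_act t h) /\ info_act t h `<=` measurable;
  info_le_act : forall t h, (h < H)%N -> info t h `<=` info_act t h;
  info_act_le : forall t h, (h < H)%N -> info_act t h `<=` info t h.+1;
  info_next_episode : forall t, info t H `<=` info t.+1 0;
  state_init : forall t w, state t 0 w = init M;
  action_adapted : forall t h, (h < H)%N ->
    discrete_measurable (info_act t h) (action t h);
  reward_adapted : forall t h, (h < H)%N ->
    rv_measurable (info t h.+1) (reward t h);
  state_adapted : forall t h, (h < H)%N ->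
    discrete_measurable (info t h.+1) (state t h.+1);
  policy_stochastic : forall t w, stochastic_policy H (policy t w);
  policy_adapted : forall t h s a, (h < H)%N ->
    rv_measurable (info t 0) (fun w => policy t w h s a);
  action_law : forall t h a, (h < H)%N ->
    cond_expectation P (info t h)
      (fun w => (action t h w == a)%:R)
      (fun w => policy t w h (state t h w) a);
  state_law : forall t h s', (h < H)%N ->
    cond_expectation P (info_act t h)
      (fun w => (state t h.+1 w == s')%:R)
      (fun w => trans M h (state t h w) (action t h w) s');
  reward_bounded : forall t h, (h < H)%N ->
    {ae P, forall w, 0 <= reward t h w <= 1};
  reward_mean : forall t h, (h < H)%N ->
    cond_expectation P (info_act t h)
      (reward t h)
      (fun w => mean_reward M h (state t h w) (action t h w)) }.

Section Empirical.
Context (d : measure_display) (T : measurableType d) (R : realType)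
  (P : probability T R) (S A : finType) (H : nat) (M : mdp R S A H)
  (I : interaction P M).

Definition at_pair (k h : nat) (s : S) (a : A) (w : T) : bool :=
  (state I k h w == s) && (action I k h w == a).

Definition visits (t h : nat) (s : S) (a : A) (w : T) : nat :=
  (\sum_(k < t) at_pair k h s a w)%N.

(* The empirical quantities at an unvisited pair are 0, as 0^-1 = 0. *)
Definition emp_trans (t : nat) (w : T) (h : nat) (s : S) (a : A) (s' : S) : R :=
  (\sum_(k < t) (at_pair k h s a w && (state I k h.+1 w == s')))%N%:R
    / (visits t h s a w)%:R.

Definition emp_reward (t : nat) (w : T) (h : nat) (s : S) (a : A) : R :=
  (\sum_(k < t | at_pair k h s a w) reward I k h w) / (visits t h s a w)%:R.

Definition covered (t : nat) (w : T) : Prop :=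
  forall h s a, (h < H)%N -> stage_state (init M) h s ->
    (1 <= visits t h s a w)%N.

(* +oo when some triplet is never visited. *)
Definition cover_time (w : T) : \bar R :=
  ereal_inf [set (t%:R)%:E | t in [set t | covered t w]].

End Empirical.

Definition beta_p (R : realType) (S A H t : nat) (delta : R) : R :=
  4 * H%:R ^+ 2 * ln (2 / delta)
  + 24 * S%:R * A%:R * H%:R ^+ 3 * ln (1 + t%:R).

Definition beta_bpi (R : realType) (S A H t : nat) (delta : R) : R :=
  16 * H%:R ^+ 2 * ln (2 / delta)
  + 96 * S%:R * A%:R * H%:R ^+ 3 * ln (1 + t%:R).

(* Main.v *)
(* Fix a function v of the stage and the next state, with values in [0, 1], and
   tilts m_x in [-1/2, 1/2] of the triplets x.  Let N_x be the number of visits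
   of x and M_x the sum over these visits of v minus its conditional mean.  Along
   the episodes the exponential of sum_x m_x M_x - m_x^2 N_x is a
   supermartingale, so Markov's inequality bounds this exponent at each t.  A
   union bound over grids of mesh 1/(t+1) for m (dimension SAH) and v (dimension
   SH) costs 2 SAH log(1+t), and maximizing over m turns it into a bound on
   sum_x M_x^2 / N_x, uniformly in v.  The rewards are treated in the same way.
   The simulation lemma, with the value function of either model in the role of
   v, expresses the gap of values linearly in the M_x / N_x, with weights p^pi or
   phat^pi, and Cauchy-Schwarz concludes. *)
Require Import Defs.
From HB Require Import structures.
From mathcomp Require Import all_boot all_order all_algebra.
From mathcomp Require Import all_classical all_reals all_analysis.
From mathcomp Require Import measurable_realfun ring lra.
Set Implicit Arguments.
Unset Strict Implicit.
Unset Printing Implicit Defensive.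

Import Order.TTheory GRing.Theory Num.Theory.
Import numFieldNormedType.Exports.
Local Open Scope classical_set_scope.
Local Open Scope ring_scope.

(** * Elementary inequalities *)

(** A bound for one fixed [v] would not do: with weights p^pi, the simulation lemma puts the value
    function of the empirical model in the role of [v], and this function depends on the data, on
    the policy and on the reward function. Uniformity over [v] settles all policies and all [rtil]
    on one event. The model gives conditional means only through integrals over the sets of a
    sigma-algebra. The exponential of an increment is therefore bounded pointwise by an expression
    affine in the outcome, whose centered part is orthogonal to the past. Tilts up to 1/2 suffice
    because the maximizer is half of a mean deviation, itself at most 1 in absolute value; they are
    also small enough for a quadratic bound on the exponential. Two degeneracies shape the
    statements below. Rewards lie in [0, 1] only almost surely. At the first stage, states other
    than the initial one are never visited, so their empirical rows are 0 and their mean rewards are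
    unconstrained. *)

Lemma expR_le_quadratic (R : realType) (x : R) :
  x <= 2^-1 -> expR x <= 1 + x + x ^+ 2.
Proof.
move=> x_le.
have [x_le0|x_gt0] := leP x 0.
  have h1 : 1 - x <= (expR x)^-1 by rewrite -expRN; exact: expR_ge1Dx.
  have e_gt0 := expR_gt0 x.
  have h2 : (1 - x) * expR x <= 1 by rewrite -ler_pdivlMr// mul1r.
  (* Here (1 - x)(1 + x + x^2) = 1 - x^3 >= 1. *)
  rewrite -(@ler_pM2l _ (1 - x)); last by lra.
  apply: (le_trans h2); nra.
(* For x > 0 the bound 1/(1 - x) on exp x is too weak; applied to x / 4 and raised to the fourth
   power it is sharp enough. *)
have h1 : 1 - x / 4 <= (expR (x / 4))^-1.
  by rewrite -expRN; exact: expR_ge1Dx.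
have e_gt0 := expR_gt0 (x / 4).
have h2 : (1 - x / 4) * expR (x / 4) <= 1 by rewrite -ler_pdivlMr// mul1r.
have -> : expR x = expR (x / 4) ^+ 4 by rewrite -expRM_natl; congr expR; field.
have y_gt0 : 0 < 1 - x / 4 by lra.
rewrite -(@ler_pM2l _ ((1 - x / 4) ^+ 4)) ?exprn_gt0// -exprMn.
apply: (@le_trans _ _ 1).
  by rewrite exprn_ile1// mulr_ge0// ltW.
have -> : (1 - x / 4) ^+ 4 * (1 + x + x ^+ 2)
  = 1 + x ^+ 2 * (3/8 - x * (11/16) + x ^+ 2 * (81/256)
      - x ^+ 3 * (15/256) + x ^+ 4 / 256) by field.
rewrite lerDl; apply: mulr_ge0; first exact: sqr_ge0.
have x2 : 0 <= x ^+ 2 by exact: sqr_ge0.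
have x3 : x ^+ 3 <= x ^+ 2 by rewrite exprS -[leRHS]mul1r ler_wpM2r//; lra.
have x4 : 0 <= x ^+ 4 by rewrite exprn_ge0// ltW.
lra.
Qed.

(** The left side is the moment generating function at [m] of a Bernoulli variable of mean [y].
    After centering, the second-order bound on the exponential leaves 1 + m^2 y (1 - y), which is at
    most exp(m^2). *)
Lemma bernoulli_mgf_le (R : realType) (m y : R) :
  0 <= y <= 1 -> `|m| <= 2^-1 ->
  1 + y * (expR m - 1) <= expR (m * y + m ^+ 2).
Proof.
move=> /andP[y0 y1]; rewrite ler_norml => /andP[m0 m1].
rewrite expRD -ler_pdivrMl ?expR_gt0// -expRN.
apply: (@le_trans _ _ (1 + m ^+ 2)); last exact: expR_ge1Dx.
have -> : expR (- (m * y)) * (1 + y * (expR m - 1))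
  = (1 - y) * expR (- (m * y)) + y * expR (m * (1 - y)).
  have -> : m * (1 - y) = - (m * y) + m by ring.
  by rewrite expRD; ring.
have h1 := @expR_le_quadratic R (- (m * y)) ltac:(nra).
have h2 := @expR_le_quadratic R (m * (1 - y)) ltac:(nra).
apply: (@le_trans _ _ ((1 - y) * (1 + - (m * y) + (- (m * y)) ^+ 2)
  + y * (1 + m * (1 - y) + (m * (1 - y)) ^+ 2))).
  by apply: lerD; apply: ler_wpM2l => //; lra.
have -> : (1 - y) * (1 + - (m * y) + (- (m * y)) ^+ 2)
  + y * (1 + m * (1 - y) + (m * (1 - y)) ^+ 2)
  = 1 + m ^+ 2 * (y * (1 - y)) by ring.
rewrite lerD2l -[leRHS]mulr1 ler_wpM2l ?sqr_ge0//; nra.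
Qed.

(** Discriminant argument: [D - 2 * l * W + l ^+ 2 * B] is a sum of squares weighted by [N], hence
    nonnegative for every [l], and [l = W / B] gives the claim. If [B = 0], all the weights [w x]
    vanish. *)
Lemma weighted_cauchy_schwarz (R : realType) (X : finType) (Q : pred X)
    (N w e : X -> R) (C : R) :
  (forall x, Q x -> 0 < N x) -> \sum_(x | Q x) N x * e x ^+ 2 <= C ->
  `|\sum_(x | Q x) w x * e x| <=
    Num.sqrt (C * \sum_(x | Q x) w x ^+ 2 / N x).
Proof.
move=> N_gt0 leC.
set W := \sum_(x | Q x) w x * e x; set B := \sum_(x | Q x) w x ^+ 2 / N x.
set D := \sum_(x | Q x) N x * e x ^+ 2 in leC.
have B_ge0 : 0 <= B.
  by apply: sumr_ge0 => x Qx; rewrite divr_ge0 ?sqr_ge0// ltW// N_gt0.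
suff WDB : W ^+ 2 <= D * B.
  rewrite -sqrtr_sqr ler_wsqrtr//; apply: (le_trans WDB).
  by rewrite ler_wpM2r.
have quad l : 0 <= D - 2 * l * W + l ^+ 2 * B.
  have -> : D - 2 * l * W + l ^+ 2 * B
      = \sum_(x | Q x) N x * (e x - l * (w x / N x)) ^+ 2.
    rewrite /D /W /B !mulr_sumr -sumrB -big_split/=; apply: eq_bigr => x Qx.
    by have := N_gt0 x Qx => /gt_eqF Nx; field; rewrite Nx.
  apply: sumr_ge0 => x Qx; rewrite mulr_ge0 ?sqr_ge0// ltW//; exact: N_gt0.
move: B_ge0; rewrite le_eqVlt => /orP[/eqP B0|B_gt0].
  have w0 x : Q x -> w x = 0.
    move=> Qx.
    have/eqP : w x ^+ 2 / N x = 0.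
      apply/eqP; rewrite eq_le; apply/andP; split.
        rewrite [leRHS]B0 /B (bigD1 x)//= lerDl sumr_ge0// => i /andP[Qi _].
        by rewrite divr_ge0 ?sqr_ge0// ltW// N_gt0.
      by rewrite divr_ge0 ?sqr_ge0// ltW// N_gt0.
    by rewrite mulf_eq0 invr_eq0 (gt_eqF (N_gt0 x Qx)) orbF sqrf_eq0 => /eqP.
  have -> : W = 0 by rewrite /W big1// => x Qx; rewrite w0// mul0r.
  by rewrite -B0 mulr0 expr0n.
have := quad (W / B); set l := W / B => h.
have WE : W = l * B by rewrite /l divfK// gt_eqF.
move: h; rewrite WE => h.
have h' : l ^+ 2 * B <= D by move: h; nra.
rewrite exprMn [B ^+ 2]expr2 mulrA; apply: ler_wpM2r => //; exact: ltW.
Qed.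

Lemma sqrtr_sqrMl (R : realType) (a b : R) : 0 <= a ->
  Num.sqrt (a ^+ 2 * b) = a * Num.sqrt b.
Proof. by move=> a0; rewrite sqrtrM ?sqr_ge0// sqrtr_sqr ger0_norm. Qed.

Lemma unit_grid (R : realType) (n : nat) (x : R) : 0 <= x <= 1 ->
  exists i : 'I_n.+1, 0 <= x - i%:R / n.+1%:R <= n.+1%:R^-1.
Proof.
move=> /andP[x0 x1].
have n_gt0 : 0 < n.+1%:R :> R by rewrite ltr0n.
(* At 1 the truncation would give the index n + 1, outside the grid; the last cell is closed on the
   right. *)
have [->|xneq1] := eqVneq x 1.
  exists ord_max => /=.
  have -> : 1 - n%:R / n.+1%:R = n.+1%:R^-1 :> R.
    by rewrite -[X in _ = X]mul1r -natr1; field; rewrite natr1 gt_eqF.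
  by rewrite lexx invr_ge0 ltW.
have x_lt1 : x < 1 by rewrite lt_neqAle xneq1.
have fl0 : 0 <= x * n.+1%:R by rewrite mulr_ge0// ltW.
have /andP[f1 f2] := truncn_itv fl0.
have lt : (Num.truncn (x * n.+1%:R) < n.+1)%N.
  rewrite -(ltr_nat R); apply: (le_lt_trans f1).
  by rewrite -[ltRHS]mul1r ltr_pM2r.
exists (Ordinal lt) => /=; apply/andP; split.
  by rewrite subr_ge0 ler_pdivrMr.
rewrite lerBlDr -[X in X + _]mul1r -mulrDl ler_pdivlMr//.
by rewrite addrC natr1 ltW.
Qed.

(* A quadratic form sum_x M_x^2 / (4 N_x), here with M_x = N_x e_x, is the
   supremum over m of sum_x m_x M_x - m_x^2 N_x, attained at m_x = e_x / 2; the
   grid of mesh 1/(t+1) loses at most H in this supremum. *)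
Lemma quadratic_le_of_grid (R : realType) (X : finType) (t H : nat)
    (N e M : X -> R) (L : R) :
  (forall x, 0 <= N x) -> \sum_x N x <= t%:R * H%:R ->
  (forall x, `|e x| <= 1) ->
  (forall x, `|N x * e x - M x| <= N x / t.+1%:R) ->
  (forall i : {ffun X -> 'I_t.+1},
     \sum_x ((- 2^-1 + (i x)%:R / t.+1%:R) * M x
       - (- 2^-1 + (i x)%:R / t.+1%:R) ^+ 2 * N x) <= L) ->
  \sum_x N x * e x ^+ 2 <= 4 * (L + H%:R).
Proof.
move=> N0 sumN e1 eM gridL.
have t_gt0 : 0 < t.+1%:R :> R by rewrite ltr0n.
have /choice[i iP] x : exists i : 'I_t.+1,
    0 <= (e x / 2 + 2^-1) - i%:R / t.+1%:R <= t.+1%:R^-1.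
  apply: unit_grid; have := e1 x; rewrite ler_norml => /andP[? ?]; lra.
have {gridL} := gridL [ffun x => i x].
under eq_bigr do rewrite ffunE.
move=> gridL.
suff key : \sum_x (N x * e x ^+ 2 / 4) <=
    \sum_x ((- 2^-1 + (i x)%:R / t.+1%:R) * M x
       - (- 2^-1 + (i x)%:R / t.+1%:R) ^+ 2 * N x) + H%:R.
  have := le_trans key (lerD gridL (lexx _)).
  by rewrite -mulr_suml ler_pdivrMr// mulrC.
set a : R := t.+1%:R^-1 in eM iP *.
have a_gt0 : 0 < a by rewrite invr_gt0.
have ta : t%:R * a + a = 1.
  by rewrite -[X in _ + X]mul1r -mulrDl natr1 divff// gt_eqF.
(* Loss per triplet, after completing the square: [N x * (a / 2)] for replacing [N x * e x] by [M x]
   under a tilt of at most 1/2, and [N x * a ^+ 2] for rounding the tilt [e x / 2] to the grid. *)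
apply: (@le_trans _ _ (\sum_x (((- 2^-1 + (i x)%:R * a) * M x
       - (- 2^-1 + (i x)%:R * a) ^+ 2 * N x) + N x * (a / 2 + a ^+ 2)))).
  apply: ler_sum => x _.
  have := iP x; rewrite -/a; set m : R := (i x)%:R * a => /andP[m0 m1].
  have := eM x; rewrite ler_norml => /andP[M0 M1].
  have m_ge0 : 0 <= m by rewrite mulr_ge0// ltW.
  have m_le1 : m <= 1 by have := e1 x; rewrite ler_norml => /andP[? ?]; lra.
  have h2 : N x * (e x / 2 + 2^-1 - m) ^+ 2 <= N x * a ^+ 2.
    by rewrite ler_wpM2l// ler_sqr ?nnegrE// ltW.
  have -> : N x * e x ^+ 2 / 4 = (- 2^-1 + m) * M x - (- 2^-1 + m) ^+ 2 * N x
     + (- 2^-1 + m) * (N x * e x - M x) + N x * (e x / 2 + 2^-1 - m) ^+ 2.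
    by field.
  have h1' : (- 2^-1 + m) * (N x * e x - M x) <= N x * (a / 2).
    apply: (le_trans (ler_norm _)); rewrite normrM mulrC mulrA.
    apply: ler_pM => //.
    by rewrite ler_norml; apply/andP; split; lra.
  rewrite mulrDr; lra.
rewrite big_split/= lerD2l -mulr_suml.
apply: (@le_trans _ _ (t%:R * H%:R * (a / 2 + a ^+ 2))).
  by rewrite ler_wpM2r// addr_ge0// ?sqr_ge0// divr_ge0// ltW.
have -> : t%:R * H%:R * (a / 2 + a ^+ 2) = H%:R * (t%:R * a * (2^-1 + a)).
  by ring.
rewrite -[leRHS]mulr1 ler_wpM2l//.
have -> : t%:R * a = 1 - a by lra.
nra.
Qed.

(** * Simulation lemma *)

(** Value function by backward induction. The recursion is on the number [j] of remaining stages, so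
    that stage [h] goes with [j = H - h]. *)
Fixpoint value_to_go (R : realType) (S A : finType)
    (p : nat -> S -> A -> S -> R) (r pi : nat -> S -> A -> R)
    (j h : nat) (s : S) : R :=
  if j is j'.+1 then
    \sum_(a : A) pi h s a *
      (r h s a + \sum_(s' : S) p h s a s' * value_to_go p r pi j' h.+1 s')
  else 0.

Lemma triplet_sumE (R : realType) (S A : finType) (H : nat) (s1 : S)
    (f : nat -> S -> A -> R) :
  triplet_sum H s1 f =
  \sum_(x : 'I_H * S * A | stage_state s1 x.1.1 x.1.2) f x.1.1 x.1.2 x.2.
Proof.
rewrite /triplet_sum pair_big_dep/= pair_big_dep/=.
by apply: eq_bigl => -[[h s] a]; rewrite /= andbT.
Qed.

Lemma triplet_sum_visit (R : realType) (S A : finType) (H : nat) (s1 : S)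
    (p : nat -> S -> A -> S -> R) (pi f : nat -> S -> A -> R) :
  triplet_sum H s1 (fun h s a => visit_prob s1 p pi h s a * f h s a) =
  \sum_(h < H) \sum_s \sum_a visit_prob s1 p pi h s a * f h s a.
Proof.
apply: eq_bigr => h _; rewrite [RHS](bigID (fun s => stage_state s1 h s))/=.
rewrite [X in _ = _ + X]big1 ?addr0// => s.
rewrite /stage_state negb_imply => /andP[/eqP h0 /negbTE ss1].
apply: big1 => a _; rewrite /visit_prob h0 /= ss1.
by rewrite !mul0r.
Qed.

(** By the Bellman recursion of [q], the summand at stage h is the change from h to h + 1 of the sum
    of [value_to_go] weighted by the state probabilities of [p]. *)
Lemma simulation_telescope (R : realType) (S A : finType) (H : nat) (s1 : S)
    (p q : nat -> S -> A -> S -> R) (r pi : nat -> S -> A -> R) (n : nat) :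
  (n <= H)%N ->
  \sum_(h < n) \sum_s \sum_a visit_prob s1 p pi h s a *
      (\sum_s' (p h s a s' - q h s a s') *
         value_to_go q r pi (H - h.+1) h.+1 s' - r h s a) =
  \sum_s state_prob s1 p pi n s * value_to_go q r pi (H - n) n s
  - value_to_go q r pi H 0 s1.
Proof.
elim: n => [_|n IHn nH].
  rewrite big_ord0 subn0 (bigD1 s1)//= eqxx mul1r big1 ?addr0 ?subrr//.
  by move=> s /negbTE ->; rewrite mul0r.
rewrite big_ord_recr/= IHn ?(ltnW nH)// addrAC; congr (_ - _).
have -> : (H - n)%N = (H - n.+1).+1 by rewrite subnSK.
rewrite -big_split/=.
under [RHS]eq_bigr => s' _.
  rewrite mulr_suml; under eq_bigr do rewrite mulr_suml; over.
rewrite [RHS]exchange_big/=; apply: eq_bigr => s _.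
rewrite mulr_sumr -big_split/= [RHS]exchange_big/=; apply: eq_bigr => a _.
rewrite /visit_prob mulrA -mulrDr [r n s a + _]addrC addrACA subrr addr0.
rewrite -big_split/= mulr_sumr; apply: eq_bigr => s' _.
by rewrite -mulrDl addrC subrK mulrA.
Qed.

Lemma simulation_identity (R : realType) (S A : finType) (H : nat) (s1 : S)
    (p q : nat -> S -> A -> S -> R) (r r' pi : nat -> S -> A -> R) :
  value H s1 p r pi - value H s1 q r' pi =
  triplet_sum H s1 (fun h s a => visit_prob s1 p pi h s a *
    (r h s a - r' h s a + \sum_s' (p h s a s' - q h s a s') *
       value_to_go q r' pi (H - h.+1) h.+1 s')).
Proof.
have tele := @simulation_telescope R S A H s1 _ q r' pi H (leqnn H).
have end0 (f : S -> R) :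
    \sum_s f s * value_to_go q r' pi (H - H) H s = 0.
  by rewrite subnn big1// => s _; rewrite mulr0.
(* Telescoping along [q] itself, where the transition gap is 0, identifies the two forms of the
   value. *)
have value_q : value H s1 q r' pi = value_to_go q r' pi H 0 s1.
  have := tele q; rewrite end0 add0r => /(congr1 -%R); rewrite opprK => <-.
  rewrite /value triplet_sum_visit -sumrN; apply: eq_bigr => h _.
  rewrite -sumrN; apply: eq_bigr => s _.
  rewrite -sumrN; apply: eq_bigr => a _.
  by rewrite big1 ?sub0r ?mulrN ?opprK// => s' _; rewrite subrr mul0r.
rewrite value_q; have := tele p; rewrite end0 add0r => <-.
rewrite /value !triplet_sum_visit -big_split/=; apply: eq_bigr => h _.
rewrite -big_split/=; apply: eq_bigr => s _.
rewrite -big_split/=; apply: eq_bigr => a _.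
by rewrite -mulrDr; congr (_ * _); rewrite -addrA [X in _ = _ + X]addrC.
Qed.

Lemma distr_mean_range (R : realType) (X : finType) (f g : X -> R) (c : R) :
  is_distr f -> (forall x, 0 <= g x <= c) -> 0 <= \sum_x f x * g x <= c.
Proof.
move=> [f0 f1] gc; apply/andP; split.
  by apply: sumr_ge0 => x _; rewrite mulr_ge0//; have /andP[] := gc x.
rewrite -[leRHS]mul1r -f1 mulr_suml; apply: ler_sum => x _.
by rewrite ler_wpM2l//; have /andP[] := gc x.
Qed.

(** Only stages [h > 0] are considered: at stage 0 an empirical row away from the initial state is
    0, not a distribution. The simulation lemma evaluates [value_to_go] at stages [h.+1] only. *)
Lemma value_to_go_range (R : realType) (S A : finType) (H : nat)
    (q : nat -> S -> A -> S -> R) (r pi : nat -> S -> A -> R) :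
  stochastic_policy H pi ->
  (forall h s a, (0 < h < H)%N -> is_distr (q h s a)) ->
  (forall h s a, (0 < h < H)%N -> 0 <= r h s a <= 1) ->
  forall j h s, (0 < h)%N -> (h + j <= H)%N ->
    0 <= value_to_go q r pi j h s <= j%:R.
Proof.
move=> piP qP rP; elim=> [h s _ _|j IHj h s h0]; first by rewrite /= lexx.
rewrite addnS => hjH; have hH : (h < H)%N.
  by apply: leq_trans hjH; rewrite ltnS leq_addr.
apply: distr_mean_range; first exact: piP.
move=> a; have /andP[r0 r1] := rP h s a ltac:(by rewrite h0).
have /andP[v0 v1] : 0 <= \sum_s' q h s a s' * value_to_go q r pi j h.+1 s'
    <= j%:R.
  by apply: distr_mean_range => [|s']; [apply: qP; rewrite h0|apply: IHj].
by rewrite addr_ge0//= -natr1 addrC lerD.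
Qed.

Lemma transition_gap_le (R : realType) (S A : finType) (H : nat) (s1 : S)
    (p q : nat -> S -> A -> S -> R) (r pi N : nat -> S -> A -> R) (C : R) :
  stochastic_policy H pi ->
  (forall h s a, (0 < h < H)%N -> is_distr (q h s a)) ->
  (forall h s a, (0 < h < H)%N -> 0 <= r h s a <= 1) ->
  (forall h s a, (h < H)%N -> stage_state s1 h s -> 0 < N h s a) ->
  (forall v : nat -> S -> R, (forall h s, 0 <= v h s <= 1) ->
    triplet_sum H s1 (fun h s a => N h s a *
      (\sum_s' (p h s a s' - q h s a s') * v h s') ^+ 2) <= C) ->
  `|triplet_sum H s1 (fun h s a => visit_prob s1 p pi h s a *
      \sum_s' (p h s a s' - q h s a s') *
        value_to_go q r pi (H - h.+1) h.+1 s')| <=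
  Num.sqrt (H%:R ^+ 2 * C *
    triplet_sum H s1 (fun h s a => visit_prob s1 p pi h s a ^+ 2 / N h s a)).
Proof.
move=> piP qP rP N0 vC.
have [->|H0] := posnP H.
  by rewrite /triplet_sum big_ord0 normr0 sqrtr_ge0.
have HR0 : 0 < H%:R :> R by rewrite ltr0n.
rewrite !triplet_sumE; apply: weighted_cauchy_schwarz => [[[h s] a] /=|].
  by move=> ?; apply: N0.
(* The value at the next stage, scaled by [H] to lie in [0, 1]; undoing the scaling produces the
   factor [H ^+ 2]. The default 0 keeps the range at the stages from [H] on. *)
pose v h s := if (h < H)%N then value_to_go q r pi (H - h.+1) h.+1 s / H%:R
  else 0.
have v01 h s : 0 <= v h s <= 1.
  rewrite /v; case: ifPn => hH; last by rewrite lexx ler01.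
  have /andP[v0 v1] := @value_to_go_range R S A H q r pi piP qP rP
    (H - h.+1)%N h.+1 s isT ltac:(by rewrite subnKC).
  rewrite divr_ge0 ?(ltW HR0)//= ler_pdivrMr// mul1r (le_trans v1)// ler_nat.
  exact: leq_subr.
have := vC v v01; rewrite -(ler_pM2l (_ : 0 < H%:R ^+ 2)) ?exprn_gt0//.
rewrite triplet_sumE mulr_sumr; apply: le_trans.
rewrite le_eqVlt; apply/orP; left; apply/eqP.
apply: eq_bigr => -[[h s] a] /= _; rewrite [RHS]mulrCA -exprMn mulr_sumr.
congr (_ * _ ^+ 2); apply: eq_bigr => s' _.
by rewrite /v ltn_ord mulrCA [H%:R * _]mulrC divfK// gt_eqF.
Qed.

(** The gap splits into a reward part and a transition part, each at most the square root of
    [H ^+ 2 * C] times the weight sum; doubling the root gives the factor 4. The reward part alone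
    would need only [C], and is enlarged by [H ^+ 2 >= 1]. *)
Lemma value_gap_le (R : realType) (S A : finType) (H : nat) (s1 : S)
    (p q : nat -> S -> A -> S -> R) (r r' pi N : nat -> S -> A -> R) (C : R) :
  stochastic_policy H pi ->
  (forall h s a, (0 < h < H)%N -> is_distr (q h s a)) ->
  (forall h s a, (0 < h < H)%N -> 0 <= r' h s a <= 1) ->
  (forall h s a, (h < H)%N -> stage_state s1 h s -> 0 < N h s a) ->
  (forall v : nat -> S -> R, (forall h s, 0 <= v h s <= 1) ->
    triplet_sum H s1 (fun h s a => N h s a *
      (\sum_s' (p h s a s' - q h s a s') * v h s') ^+ 2) <= C) ->
  triplet_sum H s1 (fun h s a => N h s a * (r h s a - r' h s a) ^+ 2) <= C ->
  `|value H s1 p r pi - value H s1 q r' pi| <=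
  Num.sqrt (4 * (H%:R ^+ 2 * C) *
    triplet_sum H s1 (fun h s a => visit_prob s1 p pi h s a ^+ 2 / N h s a)).
Proof.
move=> piP qP rP N0 vC rC.
have [H0|H0] := posnP H.
  by rewrite H0 /value /triplet_sum !big_ord0 subrr normr0 sqrtr_ge0.
set B := triplet_sum H s1 (fun h s a => _ ^+ 2 / _).
rewrite simulation_identity.
have -> : 4 * (H%:R ^+ 2 * C) * B = 2 ^+ 2 * (H%:R ^+ 2 * C * B) by ring.
rewrite sqrtr_sqrMl// mulr_natl mulr2n.
rewrite triplet_sumE; under eq_bigr do rewrite mulrDr.
rewrite big_split/=; apply: (le_trans (ler_normD _ _)); apply: lerD; last first.
  have := @transition_gap_le R S A H s1 p q r' pi N C piP qP rP N0 vC.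
  by rewrite triplet_sumE.
have B0 : 0 <= B.
  rewrite /B triplet_sumE sumr_ge0// => -[[h s] a] /= ss.
  by rewrite divr_ge0 ?sqr_ge0// ltW// N0.
have C0 : 0 <= C.
  apply: le_trans rC; rewrite triplet_sumE sumr_ge0// => -[[h s] a] /= ss.
  by rewrite mulr_ge0 ?sqr_ge0// ltW// N0.
apply: (@le_trans _ _ (Num.sqrt (C * B))).
  rewrite /B triplet_sumE.
  apply: (@weighted_cauchy_schwarz R ('I_H * S * A)%type _
    (fun x => N x.1.1 x.1.2 x.2)
    (fun x => visit_prob s1 p pi x.1.1 x.1.2 x.2)
    (fun x => r x.1.1 x.1.2 x.2 - r' x.1.1 x.1.2 x.2)) => [[[h s] a] /=|].
    exact: N0.
  by move: rC; rewrite triplet_sumE.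
rewrite ler_wsqrtr// -mulrA -[leLHS]mul1r ler_wpM2r ?mulr_ge0//.
by rewrite exprn_ege1// ler1n.
Qed.

(** * Sub-sigma-algebras and orthogonality *)

(** Turns a sub-sigma-algebra into a measurable type, so that closure properties of measurable
    functions apply to it. *)
Lemma rv_measurableP (T : pointedType) (R : realType) (G : set (set T))
    (X : T -> R) : sigma_algebra setT G ->
  rv_measurable G X <->
  measurable_fun [set: g_sigma_algebraType G] (X : g_sigma_algebraType G -> R).
Proof.
move=> sG; split.
  move=> GX _ B mB; rewrite measurable_g_measurableTypeE//.
  by apply: GX; exists B.
move=> mX _ [B mB <-]; have := mX measurableT B mB.
by rewrite measurable_g_measurableTypeE.
Qed.

Lemma rv_measurable_sub (T : Type) (R : realType) (G G' : set (set T))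
    (X : T -> R) : G `<=` G' -> rv_measurable G X -> rv_measurable G' X.
Proof. by move=> GG' GX A /GX /GG'. Qed.

Lemma rv_measurable_fun d (T : measurableType d) (R : realType)
    (G : set (set T)) (X : T -> R) :
  G `<=` measurable -> rv_measurable G X -> measurable_fun setT X.
Proof. by move=> Gm GX _ B mB; apply: Gm; apply: GX; exists B. Qed.

Lemma discrete_preimage (T : pointedType) (X : finType) (G : set (set T))
    (x : T -> X) (B : set X) :
  sigma_algebra setT G -> Defs.discrete_measurable G x -> G (x @^-1` B).
Proof.
move=> sG Gx.
have -> : x @^-1` B = \bigcup_(v in B) (x @^-1` [set v]).
  by apply/seteqP; split=> [w Bw|w [v Bv /= ->]//]; exists (x w).
rewrite -(measurable_g_measurableTypeE sG).
apply: fin_bigcup_measurable; first exact: finite_finset.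
by move=> v _; rewrite measurable_g_measurableTypeE.
Qed.

Lemma discrete_rv_measurable (T : pointedType) (R : realType) (X : finType)
    (G : set (set T)) (x : T -> X) (f : X -> R) :
  sigma_algebra setT G -> Defs.discrete_measurable G x ->
  rv_measurable G (f \o x).
Proof.
move=> sG Gx _ [B mB <-]; rewrite setTI comp_preimage.
exact: discrete_preimage.
Qed.

Lemma discrete_pair (T : pointedType) (X Y : finType) (G : set (set T))
    (x : T -> X) (y : T -> Y) :
  sigma_algebra setT G ->
  Defs.discrete_measurable G x -> Defs.discrete_measurable G y ->
  Defs.discrete_measurable G (fun w => (x w, y w)).
Proof.
move=> sG Gx Gy [v u].
have -> : (fun w => (x w, y w)) @^-1` [set (v, u)] =
    x @^-1` [set v] `&` y @^-1` [set u].
  by apply/seteqP; split=> w /=; [case=> -> ->|case=> -> ->].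
rewrite -(measurable_g_measurableTypeE sG).
by apply: measurableI; rewrite measurable_g_measurableTypeE.
Qed.

Section Orthogonality.
Context (d : measure_display) (T : measurableType d) (R : realType)
  (P : probability T R).

Lemma integrable_bounded (f : T -> R) (C : R) :
  measurable_fun setT f -> (forall w, `|f w| <= C) ->
  P.-integrable setT (EFin \o f).
Proof.
move=> mf fC; apply: measurable_bounded_integrable => //.
  by rewrite (le_lt_trans (probability_le1 P measurableT)) ?ltry.
exists C; split; first exact: num_real.
by move=> r Cr w _; apply: le_trans (fC w) (ltW Cr).
Qed.

(** The sum counts the positive integers up to [x]: it is the floor, written as a combination of
    indicators of superlevel sets. *)
Lemma sum_indic_floor (n : nat) (x : R) : 0 <= x <= n%:R ->
  0 <= x - \sum_(i < n) (i.+1%:R <= x)%R%:R <= 1.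
Proof.
elim: n => [|n IHn]; first by rewrite big_ord0 subr0 => /andP[-> /le_trans->].
move=> /andP[x0 xn]; rewrite big_ord_recr/=.
have [xn'|nx] := leP x n%:R.
  have -> : (n.+1%:R <= x) = false.
    by apply/negbTE; rewrite -ltNge (le_lt_trans xn')// ltr_nat.
  by rewrite addr0 IHn// x0.
under eq_bigr => i _.
  have -> : (i.+1%:R <= x)%R by rewrite (le_trans _ (ltW nx))// ler_nat.
  over.
rewrite sumr_const card_ord -mulr_natl mulr1 -natr1 in xn *.
have [h|h] := leP (n%:R + 1) x; rewrite ?mulr1n ?mulr0n; lra.
Qed.

(* Z is a uniform limit of combinations of indicators of sets of G, and D
   integrates to 0 on those sets. *)
Lemma integral_mul_eq0 (G : set (set T)) (Z D : T -> R) (C : R) :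
  sigma_algebra setT G -> G `<=` measurable ->
  rv_measurable G Z -> (forall w, `|Z w| <= C) ->
  measurable_fun setT D -> (forall w, `|D w| <= 1) ->
  (forall E, G E -> \int[P]_(w in E) D w = 0) ->
  \int[P]_w (Z w * D w) = 0.
Proof.
move=> sG Gm GZ ZC mD D1 D0.
(* Adding the constant [C] to [Z] changes nothing, as [D] integrates to 0 over the whole space. *)
wlog Z0 : Z C GZ ZC / forall w, 0 <= Z w.
  move=> nneg.
  have GT : G setT by case: sG => G0 GC _; have := GC _ G0; rewrite setD0.
  have C0 : 0 <= C by apply: le_trans (ZC point).
  have mZ := rv_measurable_fun Gm GZ.
  have := nneg (fun w => Z w + C) (C + C).
  under eq_Rintegral do rewrite mulrDl.
  have iZD : P.-integrable setT (EFin \o (fun w => Z w * D w)).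
    apply: (@integrable_bounded _ C); first exact: measurable_funM.
    by move=> w; rewrite normrM -[C]mulr1 ler_pM.
  have iD : P.-integrable setT (EFin \o D) by exact: (@integrable_bounded _ 1).
  have iCD : P.-integrable setT (EFin \o (fun w => C * D w)).
    apply: (@integrable_bounded _ C); first exact: measurable_funM.
    by move=> w; rewrite normrM ger0_norm// -[leRHS]mulr1 ler_wpM2l.
  rewrite RintegralD// RintegralZl// D0// mulr0 addr0; apply.
  - apply/(rv_measurableP _ sG); apply: measurable_funD => //.
    exact/rv_measurableP.
  - move=> w; apply: (le_trans (ler_normD _ _)).
    by rewrite lerD// ger0_norm.
  - by move=> w; have := ZC w; rewrite ler_norml => /andP[? _]; lra.
have C0 : 0 <= C by apply: le_trans (Z0 point) (le_trans (ler_norm _) (ZC _)).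
have mZ := rv_measurable_fun Gm GZ.
have [K KC] : exists K : nat, C <= K%:R.
  by exists (Num.truncn C).+1; exact/ltW/truncnS_gt.
have iZD : P.-integrable setT (EFin \o (fun w => Z w * D w)).
  apply: (@integrable_bounded _ C); first exact: measurable_funM.
  by move=> w; rewrite normrM -[C]mulr1 ler_pM.
apply/eqP; rewrite -normr_eq0 eq_le normr_ge0 andbT.
apply/ler_addgt0Pr => e e0; rewrite add0r.
pose n := (Num.truncn e^-1).+1.
have n0 : 0 < n%:R :> R by rewrite ltr0n.
have ne : n%:R^-1 <= e.
  by rewrite -[e]invrK lef_pV2 ?posrE ?invr_gt0//; exact/ltW/truncnS_gt.
(* The floor of [n * Z] capped at [m]. With [m = n * K] the cap is inactive, and dividing by [n]
   approximates [Z] within 1/n. *)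
pose Zn m w := \sum_(i < m) \1_[set w | i.+1%:R <= n%:R * Z w] w : R.
have GZi i : G [set w | i.+1%:R <= n%:R * Z w].
  rewrite -(measurable_g_measurableTypeE sG).
  rewrite -[X in _ X]setTI.
  apply: measurable_fun_ler => //; apply: measurable_funM => //.
  exact/rv_measurableP.
have mZi i := Gm _ (GZi i).
have Zn_ge0 m w : 0 <= Zn m w by apply: sumr_ge0.
have Zn_le m w : Zn m w <= m%:R.
  rewrite -[m in leRHS]card_ord -[leRHS]mulr1 mulr_natl -sumr_const.
  by apply: ler_sum => i _; rewrite indicE; case: (_ \in _).
have mZn m : measurable_fun setT (Zn m).
  by apply: measurable_sum => i; exact: measurable_indic.
have iZn m : P.-integrable setT (EFin \o (fun w => Zn m w * D w)).
  apply: (@integrable_bounded _ m%:R); first exact: measurable_funM.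
  by move=> w; rewrite normrM -[leRHS]mulr1 ler_pM// ger0_norm.
have Zn0 m : \int[P]_w (Zn m w * D w) = 0.
  elim: m => [|m IHm].
    under eq_Rintegral do rewrite /Zn big_ord0 mul0r.
    by rewrite Rintegral_cst// mul0r.
  under eq_Rintegral do rewrite /Zn big_ord_recr/= mulrDl.
  have iE : P.-integrable setT
      (EFin \o (fun w => \1_[set w | m.+1%:R <= n%:R * Z w] w * D w)).
    apply: (@integrable_bounded _ 1).
      by apply: measurable_funM => //; exact: measurable_indic.
    move=> w; rewrite normrM -[leRHS]mulr1 ler_pM// indicE.
    by case: (_ \in _); rewrite ?normr1 ?normr0.
  rewrite RintegralD//; last exact: iZn.
  rewrite [X in X + _]IHm add0r -[RHS](D0 _ (GZi m)) [RHS]Rintegral_mkcond.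
  by apply: eq_Rintegral => w _; rewrite patch_indic mulrC.
pose V := Zn (n * K)%N.
have approx w : `|Z w - n%:R^-1 * V w| <= n%:R^-1.
  have := @sum_indic_floor (n * K) (n%:R * Z w).
  rewrite mulr_ge0//= natrM ler_wpM2l//; last first.
    by rewrite (le_trans _ KC)// (le_trans (ler_norm _) (ZC w)).
  move=> /(_ isT).
  have -> : \sum_(i < n * K) (i.+1%:R <= n%:R * Z w)%R%:R = V w.
    apply: eq_bigr => i _; rewrite indicE; congr (_%:R); congr nat_of_bool.
    by apply/idP/idP; rewrite in_setE.
  move=> /andP[v0 v1].
  have -> : Z w - n%:R^-1 * V w = n%:R^-1 * (n%:R * Z w - V w).
    by rewrite mulrBr mulKf// gt_eqF.
  by rewrite ger0_norm ?mulr_ge0 ?invr_ge0// ger_pMr ?invr_gt0.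
apply: le_trans ne.
have iVD : P.-integrable setT (EFin \o (fun w => n%:R^-1 * (V w * D w))).
  apply: (@integrable_bounded _ (n%:R^-1 * (n * K)%:R)).
    by apply: measurable_funM => //; apply: measurable_funM => //; exact: mZn.
  move=> w; rewrite normrM ger0_norm ?invr_ge0// ler_wpM2l ?invr_ge0//.
  by rewrite normrM -[leRHS]mulr1 ler_pM// ger0_norm ?Zn_ge0 ?Zn_le.
have -> : \int[P]_w (Z w * D w) =
    \int[P]_w ((Z w - n%:R^-1 * V w) * D w).
  under [RHS]eq_Rintegral do rewrite mulrBl -mulrA.
  by rewrite RintegralB// RintegralZl// ?Zn0 ?mulr0 ?subr0//; exact: iZn.
have mdiff : measurable_fun setT (fun w => (Z w - n%:R^-1 * V w) * D w).
  apply: measurable_funM => //; apply: measurable_funB => //.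
  by apply: measurable_funM => //; exact: mZn.
have diff_le w : `|(Z w - n%:R^-1 * V w) * D w| <= n%:R^-1.
  by rewrite normrM -[leRHS]mulr1 ler_pM.
apply: le_trans.
  apply: le_normr_Rintegral => //; exact: integrable_bounded diff_le.
apply: (@le_trans _ _ (\int[P]_w (n%:R^-1 : R))).
  apply: le_Rintegral => //.
  - apply: (@integrable_bounded _ n%:R^-1); first exact: measurableT_comp.
    by move=> w; rewrite normr_id.
  - apply: (@integrable_bounded _ `|n%:R^-1|); first exact: measurable_cst.
    by [].
rewrite Rintegral_cst// [X in fine X](_ : _ = 1%E) ?mulr1//.
exact: probability_setT.
Qed.

End Orthogonality.

(** * Exponential moments *)

(** Convexity: the tangent at [m * y] lies below the exponential at 0 and at [m]; weight these two
    bounds by 1 - y and y. The right side is affine in [y], so its conditional expectation involves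
    only the mean of an outcome. *)
Lemma expRM_le_chord (R : realType) (m y : R) : 0 <= y <= 1 ->
  expR (m * y) <= 1 + y * (expR m - 1).
Proof.
move=> /andP[y0 y1]; have e_gt0 := expR_gt0 (m * y).
have h1 : (1 - m * y) * expR (m * y) <= 1.
  rewrite -ler_pdivlMr// mul1r -expRN; exact: expR_ge1Dx.
have h2 : (1 + (m - m * y)) * expR (m * y) <= expR m.
  by rewrite -ler_pdivlMr// -expRB; exact: expR_ge1Dx.
have h1' := ler_wpM2l (_ : 0 <= 1 - y) h1.
have h2' := ler_wpM2l y0 h2.
have : (1 - y) * ((1 - m * y) * expR (m * y))
    + y * ((1 + (m - m * y)) * expR (m * y)) = expR (m * y) by ring.
have := h1' ltac:(lra); lra.
Qed.

Lemma sum_nat_le1 (R : realType) (n : nat) (f : nat -> R) :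
  (forall i, (i < n)%N -> f i <= 1) -> \sum_(i < n) f i <= n%:R.
Proof.
move=> f1; rewrite -[n in leRHS]card_ord -[leRHS]mulr1 mulr_natl -sumr_const.
by apply: ler_sum => i _; exact: f1.
Qed.

Lemma rv_measurableB (T : pointedType) (R : realType) (G : set (set T)) (f g : T -> R) :
  sigma_algebra setT G -> rv_measurable G f -> rv_measurable G g ->
  rv_measurable G (fun w => f w - g w).
Proof.
move=> sG /(rv_measurableP _ sG) mf /(rv_measurableP _ sG) mg.
by apply/(rv_measurableP _ sG); exact: measurable_funB.
Qed.

Lemma rv_measurableD (T : pointedType) (R : realType) (G : set (set T)) (f g : T -> R) :
  sigma_algebra setT G -> rv_measurable G f -> rv_measurable G g ->
  rv_measurable G (fun w => f w + g w).
Proof.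
move=> sG /(rv_measurableP _ sG) mf /(rv_measurableP _ sG) mg.
by apply/(rv_measurableP _ sG); exact: measurable_funD.
Qed.

Lemma rv_measurableM (T : pointedType) (R : realType) (G : set (set T)) (f g : T -> R) :
  sigma_algebra setT G -> rv_measurable G f -> rv_measurable G g ->
  rv_measurable G (fun w => f w * g w).
Proof.
move=> sG /(rv_measurableP _ sG) mf /(rv_measurableP _ sG) mg.
by apply/(rv_measurableP _ sG); exact: measurable_funM.
Qed.

Lemma rv_measurable_expR (T : pointedType) (R : realType) (G : set (set T)) (f : T -> R) :
  sigma_algebra setT G -> rv_measurable G f ->
  rv_measurable G (fun w => expR (f w)).
Proof.
move=> sG /(rv_measurableP _ sG) mf; apply/(rv_measurableP _ sG).
exact: measurableT_comp.
Qed.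

Section Interaction.
Context (d : measure_display) (T : measurableType d) (R : realType)
  (P : probability T R) (S A : finType) (H : nat) (M : mdp R S A H)
  (I : interaction P M).

Definition state_action (k h : nat) (w : T) : S * A :=
  (state I k h w, action I k h w).

(** The common interface of rewards and of functions of the next state. The conditional mean is
    encoded by vanishing integrals over the sets of [info_act]; the bounds hold at every point,
    which makes the exponentials below bounded. *)
Definition centered_outcome (Y : nat -> nat -> T -> R)
    (y : nat -> S -> A -> R) : Prop :=
  [/\ forall k h w, 0 <= Y k h w <= 1,
      forall h s a, (h < H)%N -> 0 <= y h s a <= 1,
      forall k h, (h < H)%N -> rv_measurable (info I k h.+1) (Y k h)
    & forall k h E, (h < H)%N -> info_act I k h E ->
        \int[P]_(w in E) (Y k h w - y h (state I k h w) (action I k h w)) = 0].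

Lemma info_le_succ (k h : nat) : (h < H)%N -> info I k h `<=` info I k h.+1.
Proof.
by move=> hH B /(info_le_act hH); exact: info_act_le.
Qed.

Lemma state_info (k h : nat) : (h <= H)%N ->
  Defs.discrete_measurable (info I k h) (state I k h).
Proof.
case: h => [|h] hH; last exact: state_adapted.
have [[G0 GC _] _] := info_sigma I k hH.
move=> v; have [vi|vi] := pselect (v = init M).
  have -> : state I k 0 @^-1` [set v] = setT `\` set0.
    by rewrite setD0; apply/seteqP; split => // w _ /=; rewrite state_init.
  exact: GC.
have -> : state I k 0 @^-1` [set v] = set0.
  by apply/seteqP; split => // w /=; rewrite state_init => /esym.
exact: G0.
Qed.

Lemma state_action_info_act (k h : nat) : (h < H)%N ->
  Defs.discrete_measurable (info_act I k h) (state_action k h).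
Proof.
move=> hH; have [sG _] := info_act_sigma I k hH.
apply: discrete_pair => //; last exact: action_adapted.
by move=> v; apply: info_le_act => //; apply: state_info; exact: ltnW.
Qed.

Section Exponential_moment.
Variables (Y : nat -> nat -> T -> R) (y m : nat -> S -> A -> R).
Hypothesis Yy : centered_outcome Y y.
Hypothesis m_small : forall h s a, `|m h s a| <= 2^-1.

Definition increment (k h : nat) (w : T) : R :=
  let s := state I k h w in let a := action I k h w in
  m h s a * (Y k h w - y h s a) - m h s a ^+ 2.

(** Time runs stage by stage: [t] complete episodes, then the first [j] stages of episode [t]. The
    ends match, since [exponent t H] equals [exponent t.+1 0]. *)
Definition exponent (t j : nat) (w : T) : R :=
  \sum_(k < t) \sum_(h < H) increment k h w + \sum_(h < j) increment t h w.

Lemma increment_le1 (k h : nat) (w : T) : (h < H)%N -> increment k h w <= 1.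
Proof.
move=> hH; case: Yy => Y01 y01 _ _; rewrite /increment /=.
have := m_small h (state I k h w) (action I k h w).
have := Y01 k h w; have := y01 h (state I k h w) (action I k h w) hH.
move=> /andP[? ?] /andP[? ?]; rewrite ler_norml => /andP[? ?].
by rewrite expr2; nra.
Qed.

Lemma exponent_le (t j : nat) (w : T) : (j <= H)%N ->
  exponent t j w <= t%:R * H%:R + j%:R.
Proof.
move=> jH; apply: lerD; last first.
  by apply: (@sum_nat_le1 R j (fun h => increment t h w)) => h hj;
    apply: increment_le1; exact: leq_trans jH.
rewrite mulr_natl -[t in leRHS]card_ord -sumr_const; apply: ler_sum => k _.
by apply: (@sum_nat_le1 R H (fun h => increment k h w)) => h hH;
  exact: increment_le1.
Qed.

Lemma rv_measurable_increment (k h : nat) : (h < H)%N ->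
  rv_measurable (info I k h.+1) (increment k h).
Proof.
move=> hH; case: Yy => _ _ mY _; have [sG _] := info_sigma I k hH.
have pairG (f : S * A -> R) :
    rv_measurable (info I k h.+1) (f \o state_action k h).
  apply: discrete_rv_measurable => // v; apply: info_act_le => //.
  exact: state_action_info_act.
apply: rv_measurableB => //; last exact: (pairG (fun x => m h x.1 x.2 ^+ 2)).
apply: rv_measurableM => //; first exact: (pairG (fun x => m h x.1 x.2)).
apply: rv_measurableB => //; first exact: mY.
exact: (pairG (fun x => y h x.1 x.2)).
Qed.

Lemma exponentS (t j : nat) (w : T) :
  exponent t j.+1 w = exponent t j w + increment t j w.
Proof. by rewrite /exponent big_ord_recr/= addrA. Qed.

Lemma exponent_next (t : nat) (w : T) : exponent t.+1 0 w = exponent t H w.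
Proof. by rewrite /exponent big_ord0 addr0 big_ord_recr. Qed.

Lemma rv_measurable_exponent (t j : nat) : (j <= H)%N ->
  rv_measurable (info I t j) (exponent t j).
Proof.
elim: t j => [|t IHt]; elim=> [|j IHj] jH.
- have [sG _] := info_sigma I 0 jH.
  have -> : exponent 0 0 = (fun=> 0).
    by apply/funext => w; rewrite /exponent !big_ord0 addr0.
  by apply/(rv_measurableP _ sG); exact: measurable_cst.
- have [sG _] := info_sigma I 0 jH.
  rewrite (_ : exponent 0 j.+1 = (fun w => exponent 0 j w + increment 0 j w)).
    apply: rv_measurableD => //; last exact: rv_measurable_increment.
    by apply: rv_measurable_sub (IHj (ltnW jH)); exact: info_le_succ.
  by apply/funext => w; exact: exponentS.
- rewrite (_ : exponent t.+1 0 = exponent t H).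
    by apply: rv_measurable_sub (IHt _ (leqnn H)); exact: info_next_episode.
  by apply/funext => w; exact: exponent_next.
- have [sG _] := info_sigma I t.+1 jH.
  rewrite (_ : exponent t.+1 j.+1 =
      (fun w => exponent t.+1 j w + increment t.+1 j w)).
    apply: rv_measurableD => //; last exact: rv_measurable_increment.
    by apply: rv_measurable_sub (IHj (ltnW jH)); exact: info_le_succ.
  by apply/funext => w; exact: exponentS.
Qed.

Lemma measurable_exponent (t j : nat) : (j <= H)%N ->
  measurable_fun setT (exponent t j).
Proof.
move=> jH; have [_ mG] := info_sigma I t jH.
exact: rv_measurable_fun mG (@rv_measurable_exponent t j jH).
Qed.

Lemma integrable_expR_exponent (t j : nat) : (j <= H)%N ->
  P.-integrable setT (EFin \o (fun w => expR (exponent t j w))).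
Proof.
move=> jH; apply: (@integrable_bounded _ _ _ _ _ (expR (t%:R * H%:R + j%:R))).
  by apply: measurableT_comp => //; exact: measurable_exponent.
by move=> w; rewrite ger0_norm ?expR_ge0// ler_expR exponent_le.
Qed.

(** Pointwise, the new exponential is at most the old one plus [Z * D], with [Z] known when the
    action is drawn and [D] the centered outcome; this product integrates to 0. *)
Lemma exponential_moment_step (t j : nat) : (j < H)%N ->
  \int[P]_w expR (exponent t j.+1 w) <= \int[P]_w expR (exponent t j w).
Proof.
move=> jH; case: (Yy) => Y01 y01 mY Y0.
have [sG mG] := info_act_sigma I t jH.
(* Slope in the outcome of the chord bound on the exponential of the increment. *)
pose g (x : S * A) : R :=
  expR (- (m j x.1 x.2 * y j x.1 x.2) - m j x.1 x.2 ^+ 2) * (expR (m j x.1 x.2) - 1).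
pose D w := Y t j w - y j (state I t j w) (action I t j w).
pose Z w := expR (exponent t j w) * g (state_action t j w).
pose C : R := expR (t%:R * H%:R + j%:R) * (expR 1 * (expR 1 + 1)).
have D1 w : `|D w| <= 1.
  have /andP[? ?] := Y01 t j w.
  have /andP[? ?] := y01 j (state I t j w) (action I t j w) jH.
  by rewrite ler_norml /D; apply/andP; split; lra.
have mD : measurable_fun setT D.
  have [sG' mG'] := info_sigma I t jH.
  apply: measurable_funB; first exact: (rv_measurable_fun mG' (mY t j jH)).
  apply: (rv_measurable_fun mG); apply: (@discrete_rv_measurable _ _ _ _ _
    (fun x => y j x.1 x.2) sG (state_action_info_act t jH)).
have GZ : rv_measurable (info_act I t j) Z.
  apply: rv_measurableM => //.
    apply: rv_measurable_expR => //; apply: rv_measurable_sub (@rv_measurable_exponent t j _).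
      exact: info_le_act.
    exact: ltnW.
  exact: discrete_rv_measurable (state_action_info_act t jH).
have ZC w : `|Z w| <= C.
  rewrite /Z /C normrM; apply: ler_pM => //.
    by rewrite ger0_norm ?expR_ge0// ler_expR exponent_le// ltnW.
  rewrite /g; case: (state_action t j w) => s a /=.
  have := m_small j s a; rewrite ler_norml => /andP[? ?].
  have /andP[? ?] := y01 j s a jH.
  rewrite normrM; apply: ler_pM => //.
    by rewrite ger0_norm ?expR_ge0// ler_expR; nra.
  apply: (le_trans (ler_normB _ _)).
  by rewrite normr1 ger0_norm ?expR_ge0// lerD2r ler_expR; lra.
have ZD0 : \int[P]_w (Z w * D w) = 0.
  by apply: (integral_mul_eq0 sG mG GZ ZC mD D1) => E GE; exact: Y0.
have iZD : P.-integrable setT (EFin \o (fun w => Z w * D w)).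
  apply: (@integrable_bounded _ _ _ _ _ C).
    by apply: measurable_funM => //; exact: rv_measurable_fun mG GZ.
  by move=> w; rewrite normrM -[leRHS]mulr1 ler_pM.
have iE := @integrable_expR_exponent t j (ltnW jH).
rewrite -[leRHS]addr0 -ZD0 -RintegralD//.
apply: le_Rintegral => //.
- exact: integrable_expR_exponent.
- by have := integrableD measurableT iE iZD; apply: eq_integrable.
move=> w _; rewrite exponentS expRD /Z -mulrA -[X in X + _]mulr1 -mulrDr.
rewrite ler_wpM2l ?expR_ge0// /increment /g /D /=.
have := m_small j (state I t j w) (action I t j w).
set mw := m j _ _; set yw := y j _ _; set e := expR mw => mw_small.
have -> : mw * (Y t j w - yw) - mw ^+ 2 =
    (- (mw * yw) - mw ^+ 2) + mw * Y t j w by ring.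
rewrite expRD; set c := expR (- (mw * yw) - mw ^+ 2).
have c0 : 0 <= c by exact: expR_ge0.
(* The chord at the mean: the term [- m ^+ 2] in the increment exactly compensates the Bernoulli
   bound. *)
have c1 : c * (1 + yw * (e - 1)) <= 1.
  apply: (@le_trans _ _ (c * expR (mw * yw + mw ^+ 2))).
    by rewrite ler_wpM2l// bernoulli_mgf_le// y01.
  by rewrite -expRD -opprD addNr expR0.
have := ler_wpM2l c0 (expRM_le_chord mw (Y01 t j w)); rewrite -/e.
have -> : c * (1 + Y t j w * (e - 1)) =
  c * (1 + yw * (e - 1)) + c * (e - 1) * (Y t j w - yw) by ring.
by move=> h; apply: (le_trans h); rewrite lerD2r.
Qed.

Lemma exponential_moment_le1 (t j : nat) : (j <= H)%N ->
  \int[P]_w expR (exponent t j w) <= 1.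
Proof.
elim: t j => [|t IHt]; elim=> [|j IHj] jH.
- under eq_Rintegral do rewrite /exponent !big_ord0 addr0 expR0.
  rewrite Rintegral_cst// [X in fine X](_ : _ = 1%E) ?mulr1//.
  exact: probability_setT.
- exact: le_trans (exponential_moment_step 0 jH) (IHj (ltnW jH)).
- under eq_Rintegral do rewrite exponent_next.
  exact: IHt.
- exact: le_trans (exponential_moment_step t.+1 jH) (IHj (ltnW jH)).
Qed.

Lemma exponent_tail (t : nat) (L : R) :
  (P [set w | L < exponent t 0 w]%R <= (expR (- L))%:E)%E.
Proof.
set B := [set w | _].
have mX := @measurable_exponent t 0 (leq0n H).
have mB : measurable B.
  rewrite -[B]setTI; apply: measurable_fun_ltr => //; exact: measurable_cst.
have iX := @integrable_expR_exponent t 0 (leq0n H).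
have fB : fine (P B) = \int[P]_(w in B) 1 by rewrite Rintegral_cst// mul1r.
have -> : P B = (fine (P B))%:E by rewrite fineK// fin_num_measure.
rewrite lee_fin expRN -[leRHS]mul1r ler_pdivlMr ?expR_gt0//.
apply: le_trans (exponential_moment_le1 t (leq0n H)).
rewrite mulrC -Rintegral_cst// Rintegral_mkcond.
apply: le_Rintegral => //.
  apply: (@integrable_bounded _ _ _ _ _ (expR L)).
    apply/(measurable_restrictT _ mB).1; exact: measurable_cst.
  move=> w; rewrite patchE; case: ifPn => _; rewrite ?normr0 ?expR_ge0//.
  by rewrite ger0_norm ?expR_ge0.
move=> w _; rewrite patchE; case: ifPn => [|_]; last exact: expR_ge0.
by rewrite inE /B/= => /ltW; rewrite ler_expR.
Qed.

End Exponential_moment.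
End Interaction.

(** * Transitions and rewards as centered outcomes *)

Lemma Rintegral_sum (d : measure_display) (T : measurableType d)
    (R : realType) (mu : {measure set T -> \bar R}) (D : set T) (X : Type)
    (s : seq X) (f : X -> T -> R) :
  measurable D -> (forall i, mu.-integrable D (EFin \o f i)) ->
  \int[mu]_(w in D) (\sum_(i <- s) f i w) =
  \sum_(i <- s) \int[mu]_(w in D) f i w.
Proof.
move=> mD fi.
suff [] : mu.-integrable D (EFin \o (fun w => \sum_(i <- s) f i w)) /\
    \int[mu]_(w in D) (\sum_(i <- s) f i w) =
       \sum_(i <- s) \int[mu]_(w in D) f i w by [].
elim: s => [|i s [IHi IHs]].
  under eq_Rintegral do rewrite big_nil.
  rewrite Rintegral_cst// mul0r big_nil; split => //.
  have -> : (fun w => \sum_(i <- [::]) f i w) = (fun=> 0).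
    by apply/funext => w; rewrite big_nil.
  exact: integrable0.
have E : (fun w => \sum_(k <- i :: s) f k w) =
    (fun w => f i w + \sum_(k <- s) f k w).
  by apply/funext => w; rewrite big_cons.
rewrite E RintegralD// IHs big_cons; split => //.
by have := integrableD mD (fi i) IHi; apply: eq_integrable.
Qed.

Section Outcomes.
Context (d : measure_display) (T : measurableType d) (R : realType)
  (P : probability T R) (S A : finType) (H : nat) (M : mdp R S A H)
  (I : interaction P M).

Lemma transition_outcome (v : nat -> S -> R) :
  (forall h s, 0 <= v h s <= 1) ->
  centered_outcome I (fun k h w => v h (state I k h.+1 w))
    (fun h s a => \sum_s' trans M h s a s' * v h s').
Proof.
move=> v01; split=> [k h w|h s a hH|k h hH|k h E hH GE] //.
- by apply: distr_mean_range => //; exact: trans_distr.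
- have [sG _] := info_sigma I k hH.
  by apply: (discrete_rv_measurable (f := v h)) => //; exact: state_adapted.
have [sG mG] := info_act_sigma I k hH.
have [sG' mG'] := info_sigma I k hH.
have mE := mG _ GE.
pose b s' w : R := (state I k h.+1 w == s')%:R.
pose q s' w := trans M h (state I k h w) (action I k h w) s'.
have ib s' : P.-integrable E (EFin \o b s').
  apply: integrableS (@integrable_bounded _ _ _ P (b s') 1 _ _) => //.
    apply: (rv_measurable_fun mG').
    apply: (discrete_rv_measurable (f := fun s => (s == s')%:R)) => //.
    exact: state_adapted.
  by move=> w; rewrite /b; case: eqP => _; rewrite ?normr1 ?normr0.
have iq s' : P.-integrable E (EFin \o q s').
  apply: integrableS (@integrable_bounded _ _ _ P (q s') 1 _ _) => //.
    apply: (rv_measurable_fun mG).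
    apply: (discrete_rv_measurable (f := fun x => trans M h x.1 x.2 s')
      (x := state_action I k h)) => //.
    exact: state_action_info_act.
  move=> w; rewrite /q; set s := state _ _ _ _; set a := action _ _ _ _.
  have [p0 p1] := trans_distr M s a hH.
  by rewrite ger0_norm// -p1 (bigD1 s')//= lerDl sumr_ge0.
pose f s' w := v h s' * (b s' w - q s' w).
have ibq s' : P.-integrable E (EFin \o (fun w => b s' w - q s' w)).
  by have := integrableB mE (ib s') (iq s'); apply: eq_integrable.
have iF s' : P.-integrable E (EFin \o f s').
  by have := integrableZl mE (v h s') (ibq s'); apply: eq_integrable.
(* The centered value is a combination of the centered indicators of the next states, each of which
   integrates to 0 by [state_law]. *)
have -> : (fun w => v h (state I k h.+1 w) -
    \sum_s' trans M h (state I k h w) (action I k h w) s' * v h s') =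
    (fun w => \sum_s' f s' w).
  apply/funext => w; rewrite /f.
  under [RHS]eq_bigr do rewrite mulrBr [v h _ * q _ _]mulrC.
  rewrite sumrB; congr (_ - _).
  rewrite (bigD1 (state I k h.+1 w))//= /b eqxx mulr1 big1 ?addr0// => s'.
  by rewrite eq_sym => /negbTE ->; rewrite mulr0.
rewrite Rintegral_sum// big1// => s' _.
rewrite RintegralZl// RintegralB//.
have [_ _ /(_ E GE) bq] := state_law I k s' hH.
have -> : \int[P]_(w in E) b s' w = \int[P]_(w in E) q s' w.
  by rewrite /Rintegral bq.
by rewrite subrr mulr0.
Qed.

(** [centered_outcome] asks for bounds at every point, while rewards satisfy them almost surely.
    Clipping changes them only on a null set. *)
Definition clip (x : R) : R := Num.min 1 (Num.max 0 x).

Lemma clip_range (x : R) : 0 <= clip x <= 1.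
Proof. by rewrite /clip le_min ler01 le_max lexx/= ge_min lexx. Qed.

Lemma clip_id (x : R) : 0 <= x <= 1 -> clip x = x.
Proof. by move=> /andP[x0 x1]; rewrite /clip max_r// min_r. Qed.

Lemma measurable_reward (k h : nat) : (h < H)%N ->
  measurable_fun setT (reward I k h).
Proof.
move=> hH; have [_ mG] := info_sigma I k hH.
exact: (rv_measurable_fun mG (reward_adapted hH)).
Qed.

Lemma rv_measurable_clip (G : set (set T)) (f : T -> R) :
  sigma_algebra setT G -> rv_measurable G f ->
  rv_measurable G (fun w => clip (f w)).
Proof.
move=> sG /(rv_measurableP _ sG) mf; apply/(rv_measurableP _ sG).
apply: measurable_minr; first exact: measurable_cst.
by apply: measurable_maxr => //; exact: measurable_cst.
Qed.

Lemma measurable_clip_reward (k h : nat) : (h < H)%N ->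
  measurable_fun setT (fun w => clip (reward I k h w)).
Proof.
move=> hH; have [sG mG] := info_sigma I k hH.
by apply: (rv_measurable_fun mG); apply: rv_measurable_clip => //; exact: reward_adapted.
Qed.

Lemma integrable_clip_reward (k h : nat) (E : set T) : (h < H)%N ->
  measurable E -> P.-integrable E (EFin \o (fun w => clip (reward I k h w))).
Proof.
move=> hH mE; apply: integrableS (@integrable_bounded _ _ _ P _ 1 _ _) => //.
  exact: measurable_clip_reward.
by move=> w; have /andP[? ?] := clip_range (reward I k h w); rewrite ger0_norm.
Qed.

Lemma integral_clip_reward (k h : nat) (E : set T) : (h < H)%N ->
  measurable E ->
  \int[P]_(w in E) clip (reward I k h w) = \int[P]_(w in E) reward I k h w.
Proof.
move=> hH mE; congr fine; apply: ae_eq_integral => //.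
- apply/measurable_EFinP; apply: measurable_funTS.
  exact: measurable_clip_reward.
- apply/measurable_EFinP; apply: measurable_funTS.
  exact: measurable_reward.
- apply: filterS (reward_bounded I k hH) => w r01 _ /=.
  by rewrite clip_id.
Qed.

Lemma integral_mean_reward (k h : nat) (E : set T) : (h < H)%N ->
  info_act I k h E ->
  \int[P]_(w in E) reward I k h w =
  \int[P]_(w in E) mean_reward M h (state I k h w) (action I k h w).
Proof.
move=> hH GE; have [_ _ /(_ E GE) e] := reward_mean I k hH.
by rewrite /Rintegral e.
Qed.

(** For each of the finitely many pairs, the event [B] that it is met belongs to [info_act]. If [B]
    is not null, the mean reward times its probability is the integral over [B] of a reward in
    [0, 1]. *)
Lemma mean_reward_bounded (k h : nat) : (h < H)%N ->
  {ae P, forall w, 0 <= mean_reward M h (state I k h w) (action I k h w) <= 1}.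
Proof.
move=> hH.
suff : {ae P, forall w, forall x : S * A, state_action I k h w = x ->
    0 <= mean_reward M h x.1 x.2 <= 1}.
  by apply: filterS => w /(_ _ erefl).
apply: filter_forall => -[s a].
have [sG mG] := info_act_sigma I k hH.
set B := state_action I k h @^-1` [set (s, a)].
have GB : info_act I k h B by exact: state_action_info_act.
have mB : measurable B := mG _ GB.
have [PB0|PB] := eqVneq (P B) 0%E.
  apply: (negligibleS (A := B)); last exact/negligibleP.
  by move=> w /= /not_implyP[].
apply: aeW => w _ /=.
have E1 : \int[P]_(w in B) clip (reward I k h w) =
    mean_reward M h s a * fine (P B).
  rewrite integral_clip_reward// integral_mean_reward// -Rintegral_cst//.
  by apply: eq_Rintegral => w'; rewrite inE => -[-> ->].
have PB_gt0 : 0 < fine (P B).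
  by rewrite fine_gt0// lt0e PB measure_ge0/= -ge0_fin_numE// fin_num_measure.
apply/andP; split.
  rewrite -(pmulr_lge0 _ PB_gt0) -E1; apply: Rintegral_ge0 => w' _.
  by have /andP[] := clip_range (reward I k h w').
rewrite -(ler_pM2r PB_gt0) -E1 -Rintegral_cst//; apply: le_Rintegral => //.
- exact: integrable_clip_reward.
- by apply: integrableS (@integrable_bounded _ _ _ P (fun=> 1) 1 _ _) => // w';
    rewrite normr1.
- by move=> w' _; have /andP[] := clip_range (reward I k h w').
Qed.

Lemma reward_outcome :
  centered_outcome I (fun k h w => clip (reward I k h w))
    (fun h s a => clip (mean_reward M h s a)).
Proof.
split=> [k h w|h s a hH|k h hH|k h E hH GE]; try exact: clip_range.
  have [sG _] := info_sigma I k hH.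
  by apply: rv_measurable_clip => //; exact: reward_adapted.
have [sG mG] := info_act_sigma I k hH.
have mE := mG _ GE.
have mm (f : S * A -> R) : measurable_fun setT (f \o state_action I k h).
  apply: (rv_measurable_fun mG); apply: discrete_rv_measurable => //.
  exact: state_action_info_act.
have mmean := mm (fun x => mean_reward M h x.1 x.2).
have mclip := mm (fun x => clip (mean_reward M h x.1 x.2)).
rewrite RintegralB//.
- rewrite integral_clip_reward// integral_mean_reward//.
  apply/eqP; rewrite subr_eq0; apply/eqP; congr fine.
  apply: ae_eq_integral => //.
  + by apply/measurable_EFinP; apply: measurable_funTS; exact: mmean.
  + by apply/measurable_EFinP; apply: measurable_funTS; exact: mclip.
  + by apply: filterS (mean_reward_bounded k hH) => w r01 _ /=; rewrite clip_id.
- exact: integrable_clip_reward.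
- apply: integrableS (@integrable_bounded _ _ _ P _ 1 mclip _) => // w.
  by have /andP[? ?] := clip_range (mean_reward M h (state I k h w)
    (action I k h w)); rewrite ger0_norm.
Qed.

End Outcomes.

(** * Union bound over the grids *)

(** Extension by 0: a finite grid needs the stages in ['I_H], whereas families of the model are
    indexed by [nat]. *)
Definition on_stages (R : realType) (H : nat) (f : 'I_H -> R) (h : nat) : R :=
  oapp f 0 (insub h).

Lemma on_stagesE (R : realType) (H : nat) (f : 'I_H -> R) (h : 'I_H) :
  on_stages f h = f h.
Proof. by rewrite /on_stages valK. Qed.

Definition grid_tilt {R : realType} (S A : finType) (H t : nat)
    (i : {ffun 'I_H * S * A -> 'I_t.+1}) (h : nat) (s : S) (a : A) : R :=
  on_stages (fun h' => - 2^-1 + (i (h', s, a))%:R / t.+1%:R) h.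

Definition grid_value {R : realType} (S : finType) (H t : nat)
    (j : {ffun 'I_H * S -> 'I_t.+1}) (h : nat) (s : S) : R :=
  on_stages (fun h' => (j (h', s))%:R / t.+1%:R) h.

Lemma grid_point_range (R : realType) (t : nat) (i : 'I_t.+1) :
  0 <= (i%:R / t.+1%:R : R) <= 1.
Proof.
by rewrite divr_ge0//= ler_pdivrMr ?ltr0n// mul1r ler_nat ltnW.
Qed.

Lemma grid_tilt_small (R : realType) (S A : finType) (H t : nat)
    (i : {ffun 'I_H * S * A -> 'I_t.+1}) (h : nat) (s : S) (a : A) :
  `|grid_tilt i h s a| <= 2^-1 :> R.
Proof.
rewrite /grid_tilt /on_stages; case: insub => [h'|] /=; last first.
  by rewrite normr0 invr_ge0.
have := grid_point_range R (i (h', s, a)); set x := (_ / _) => /andP[? ?].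
by rewrite ler_norml; apply/andP; split; lra.
Qed.

Lemma grid_value_range (R : realType) (S : finType) (H t : nat)
    (j : {ffun 'I_H * S -> 'I_t.+1}) (h : nat) (s : S) :
  0 <= (grid_value j h s : R) <= 1.
Proof.
rewrite /grid_value /on_stages; case: insub => [h'|] /=.
  exact: grid_point_range.
by rewrite lexx ler01.
Qed.

Lemma measure_finite_union_le (d : measure_display) (T : measurableType d)
    (R : realType) (P : probability T R) (X : finType) (F : X -> set T) (c : R) :
  (forall i, measurable (F i)) -> (forall i, (P (F i) <= c%:E)%E) ->
  (P (\big[setU/set0]_i F i) <= (#|X|%:R * c)%:E)%E.
Proof.
move=> mF Fc.
rewrite (_ : #|X|%:R * c = \sum_(i : X) c); last first.
  by rewrite sumr_const mulr_natl.
elim: (index_enum X) => [|i s IHs]; first by rewrite !big_nil measure0.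
rewrite !big_cons/= EFinD.
apply: (le_trans (measureU2 _ _ _)) => //; first exact: bigsetU_measurable.
by apply: leeD; [exact: Fc|exact: IHs].
Qed.

(** Of the factor 2(n + 1), the part 2n pays for the two grids and the remaining 2 leaves
    delta/(t+1)^2, at most delta(1/t - 1/(t+1)). The 2 in [2 / delta] pays for the reward, one more
    outcome next to the grid of values. *)
Definition log_level (R : realType) (n : nat) (delta : R) (t : nat) : R :=
  ln (2 / delta) + (2 * n.+1)%:R * ln (1 + t%:R).

Lemma grid_count_level (R : realType) (n c t : nat) (delta : R) :
  0 < delta -> (0 < t)%N -> (c <= n)%N ->
  ((t.+1 ^ c).+1 * t.+1 ^ n)%:R * expR (- log_level n delta t) <=
  delta * (t%:R^-1 - t.+1%:R^-1) :> R.
Proof.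
move=> d0 t0 cn; set b : R := t.+1%:R.
have b0 : 0 < b by rewrite ltr0n.
have tR0 : 0 < t%:R :> R by rewrite ltr0n.
have -> : expR (- log_level n delta t) = delta / 2 / b ^+ (2 * n.+1).
  rewrite /log_level opprD expRD !expRN lnK ?posrE ?divr_gt0//.
  by rewrite invf_div expRM_natl lnK ?posrE addrC natr1.
have -> : t%:R^-1 - b^-1 = (t%:R * b)^-1.
  have bE : b = t%:R + 1 by rewrite natr1.
  by rewrite bE; field; rewrite -bE !gt_eqF.
have count_le : ((t.+1 ^ c).+1 * t.+1 ^ n)%:R <= 2 * b ^+ (2 * n).
  have -> : (2 * n = n + n)%N by rewrite mul2n addnn.
  rewrite -natrX -natrM ler_nat expnD mulnA leq_mul//.
  by rewrite mul2n -addnn -addn1 leq_add ?expn_gt0// leq_pexp2l.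
apply: (@le_trans _ _ (2 * b ^+ (2 * n) * (delta / 2 / b ^+ (2 * n.+1)))).
  by rewrite ler_wpM2r// !divr_ge0 ?exprn_ge0 ?ltW.
have -> : 2 * b ^+ (2 * n) * (delta / 2 / b ^+ (2 * n.+1)) = delta / b ^+ 2.
  by rewrite mulnS addnC exprD; field; rewrite ?expf_neq0 ?gt_eqF.
rewrite ler_pM2l// lef_pV2 ?posrE ?exprn_gt0 ?mulr_gt0//.
by rewrite expr2 ler_pM2r// ler_nat.
Qed.

Section Good_event.
Context (d : measure_display) (T : measurableType d) (R : realType)
  (P : probability T R) (S A : finType) (H : nat) (M : mdp R S A H)
  (I : interaction P M).

Section Grid.
Variable t : nat.
Implicit Type j : option {ffun 'I_H * S -> 'I_t.+1}.

(* [Some v] stands for the value of the next state, [None] for the reward. *)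
Definition outcome j (k h : nat) (w : T) : R :=
  if j is Some v then grid_value v h (state I k h.+1 w)
  else clip (reward I k h w).

Definition outcome_mean j (h : nat) (s : S) (a : A) : R :=
  if j is Some v then \sum_s' trans M h s a s' * grid_value v h s'
  else clip (mean_reward M h s a).

Lemma outcomeP j : centered_outcome I (outcome j) (outcome_mean j).
Proof.
case: j => [v|]; last exact: reward_outcome.
by apply: transition_outcome => h s; exact: grid_value_range.
Qed.

Definition grid_exponent j (i : {ffun 'I_H * S * A -> 'I_t.+1}) : T -> R :=
  exponent I (outcome j) (outcome_mean j) (grid_tilt i) t 0.

Definition exceedance (L : R) : set T :=
  \big[setU/set0]_(x : option {ffun 'I_H * S -> 'I_t.+1} *
      {ffun 'I_H * S * A -> 'I_t.+1})
    [set w | L < grid_exponent x.1 x.2 w].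

Lemma measurable_grid_exceedance j i (L : R) :
  measurable [set w | L < grid_exponent j i w].
Proof.
have mlt : measurable_fun setT (fun w => L < grid_exponent j i w).
  apply: measurable_fun_ltr; first exact: measurable_cst.
  by apply: measurable_exponent; first exact: outcomeP.
by rewrite -[X in measurable X]setTI; exact: mlt.
Qed.

Lemma measurable_exceedance (L : R) : measurable (exceedance L).
Proof.
by apply: bigsetU_measurable => x _; exact: measurable_grid_exceedance.
Qed.

Lemma exceedance_le (L : R) :
  (P (exceedance L) <=
    (((t.+1 ^ (H * #|S|)).+1 * t.+1 ^ (H * #|S| * #|A|))%:R
      * expR (- L))%:E)%E.
Proof.
have := @measure_finite_union_le _ _ _ P
  (option {ffun 'I_H * S -> 'I_t.+1} * {ffun 'I_H * S * A -> 'I_t.+1})%type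
  (fun x => [set w | L < grid_exponent x.1 x.2 w]) (expR (- L)).
rewrite card_prod card_option !card_ffun !card_prod !card_ord; apply.
  by move=> x; exact: measurable_grid_exceedance.
move=> x; apply: exponent_tail; first exact: outcomeP.
exact: grid_tilt_small.
Qed.

End Grid.

Lemma good_event (delta : R) : 0 < delta -> (0 < #|A|)%N ->
  exists E : set T,
    [/\ measurable E, ((1 - delta)%:E <= P E)%E
      & forall w, E w ->
        (forall k h, (h < H)%N -> 0 <= reward I k h w <= 1 /\
           0 <= mean_reward M h (state I k h w) (action I k h w) <= 1) /\
        forall t j i, (0 < t)%N ->
          @grid_exponent t j i w <= log_level (H * #|S| * #|A|) delta t].
Proof.
move=> d0 A0; pose L t := log_level (H * #|S| * #|A|) delta t.
(* Shifted by one, since the budget delta(1/t - 1/(t+1)) starts at t = 1; over all t it telescopes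
   to delta. *)
pose F t := exceedance t.+1 (L t.+1).
have mF t : measurable (F t) by exact: measurable_exceedance.
have Fle t : (P (F t) <= (delta * (t.+1%:R^-1 - t.+2%:R^-1))%:E)%E.
  apply: (le_trans (exceedance_le _ _)); rewrite lee_fin.
  by apply: grid_count_level => //; exact: leq_pmulr.
have mUF : measurable (\bigcup_t F t) by exact: bigcup_measurable.
have UF : (P (\bigcup_t F t) <= delta%:E)%E.
  apply: (le_trans (measure_sigma_subadditive P mF mUF (@subset_refl _ _))).
  apply: lime_le; first by apply: is_cvg_nneseries.
  apply: nearW => n.
  apply: (@le_trans _ _ (\sum_(0 <= t < n)
      (delta * (t.+1%:R^-1 - t.+2%:R^-1))%:E)%E).
    by apply: lee_sum => t _; exact: Fle.
  rewrite sumEFin lee_fin -mulr_sumr -[leRHS]mulr1 ler_pM2l//.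
  rewrite -[X in X <= _]opprK -sumrN.
  under eq_bigr do rewrite opprB.
  rewrite (telescope_sumr (fun t => t.+1%:R^-1 : R))// opprB invr1.
  by rewrite lerBlDr lerDl invr_ge0.
(* One null set collects the failures of the almost sure bounds over all episodes and stages;
   removing it costs no probability. *)
have [N [mN N0 NP]] : {ae P, forall w, forall k h, (h < H)%N ->
    0 <= reward I k h w <= 1 /\
    0 <= mean_reward M h (state I k h w) (action I k h w) <= 1}.
  apply: ae_foralln => k; apply: ae_foralln => h.
  have [hH|hH] := boolP (h < H)%N; last by apply: aeW => w.
  by apply: filterS2 (reward_bounded I k hH) (mean_reward_bounded I k hH).
exists (~` (N `|` \bigcup_t F t)).
have mB : measurable (N `|` \bigcup_t F t) by exact: measurableU.
split; first exact: measurableC.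
  rewrite probability_setC// EFinB leeB//.
  by apply: (le_trans (measureU2 _ mN mUF)); rewrite [X in (X + _)%E]N0 add0e.
move=> w /not_orP[nN nF]; split.
  by apply: contrapT => h; apply: nN; apply: NP.
case=> // t j i _; rewrite leNgt; apply/negP => Lw; apply: nF.
exists t => //; by rewrite /F /exceedance (bigD1 (j, i))//=; left.
Qed.

End Good_event.

(** * Empirical deviations *)

Section Deviations.
Context (d : measure_display) (T : measurableType d) (R : realType)
  (P : probability T R) (S A : finType) (H : nat) (M : mdp R S A H)
  (I : interaction P M).
Variables (t : nat) (w : T).

Local Notation N h s a := ((visits I t h s a w)%:R : R).

Definition centered_sum (Y : nat -> nat -> T -> R) (y : nat -> S -> A -> R)
    (h : nat) (s : S) (a : A) : R :=
  \sum_(k < t | at_pair I k h s a w) (Y k h w - y h s a).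

Lemma visitsE (h : nat) (s : S) (a : A) :
  N h s a = \sum_(k < t | at_pair I k h s a w) 1.
Proof.
rewrite /visits natr_sum [RHS]big_mkcond.
by apply: eq_bigr => k _; case: at_pair.
Qed.

(** Each stage of an episode visits exactly one pair, which lets sums over time be regrouped by
    triplet. *)
Lemma sum_triplets_at_pair (k : nat) (f : nat -> S -> A -> R) :
  \sum_(x : 'I_H * S * A) (if at_pair I k x.1.1 x.1.2 x.2 w
    then f x.1.1 x.1.2 x.2 else 0) =
  \sum_(h < H) f h (state I k h w) (action I k h w).
Proof.
transitivity (\sum_(h < H) \sum_s \sum_a
    (if at_pair I k h s a w then f h s a else 0)).
  by rewrite pair_bigA pair_bigA; apply: eq_bigr => -[[h s] a] _.
apply: eq_bigr => h _; rewrite (bigD1 (state I k h w))//=.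
rewrite (bigD1 (action I k h w))//= {1}/at_pair !eqxx/=.
rewrite !big1 ?addr0//.
- move=> s /negbTE ns; apply: big1 => a _.
  by rewrite /at_pair eq_sym ns.
- by move=> a /negbTE na; rewrite /at_pair [_ == a]eq_sym na andbF.
Qed.

Lemma sum_visits : \sum_(x : 'I_H * S * A) N x.1.1 x.1.2 x.2 = t%:R * H%:R.
Proof.
under eq_bigr do rewrite visitsE big_mkcond/=.
rewrite exchange_big/=.
under eq_bigr => k _ do
  rewrite (sum_triplets_at_pair k (fun _ _ _ => 1)) sumr_const card_ord.
by rewrite sumr_const card_ord mulr_natl.
Qed.

Lemma exponent_triplets (Y : nat -> nat -> T -> R) (y m : nat -> S -> A -> R) :
  exponent I Y y m t 0 w =
  \sum_(x : 'I_H * S * A) (m x.1.1 x.1.2 x.2 * centered_sum Y y x.1.1 x.1.2 x.2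
     - m x.1.1 x.1.2 x.2 ^+ 2 * N x.1.1 x.1.2 x.2).
Proof.
rewrite /exponent big_ord0 addr0.
under [RHS]eq_bigr => x _ do
  rewrite visitsE /centered_sum !mulr_sumr -sumrB big_mkcond/=.
rewrite [RHS]exchange_big/=; apply: eq_bigr => k _.
rewrite (sum_triplets_at_pair k (fun h s a =>
  m h s a * (Y k h w - y h s a) - m h s a ^+ 2 * 1)).
by apply: eq_bigr => h _; rewrite mulr1.
Qed.

Lemma centered_sum_le (Y : nat -> nat -> T -> R) (y : nat -> S -> A -> R)
    (c : R) (h : nat) (s : S) (a : A) :
  (forall k, at_pair I k h s a w -> `|Y k h w - y h s a| <= c) ->
  `|centered_sum Y y h s a| <= N h s a * c.
Proof.
move=> Yc; rewrite visitsE mulr_suml; apply: (le_trans (ler_norm_sum _ _ _)).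
by apply: ler_sum => k atk; rewrite mul1r Yc.
Qed.

(** [Y'] is the grid outcome whose exponents are controlled, [Y] the nearby outcome of interest. *)
Lemma centered_sum_quadratic_le (Y Y' : nat -> nat -> T -> R)
    (y y' : nat -> S -> A -> R) (L : R) :
  (forall k h s a, (h < H)%N -> `|Y k h w - y h s a| <= 1) ->
  (forall k h s a, (h < H)%N ->
     `|(Y k h w - y h s a) - (Y' k h w - y' h s a)| <= t.+1%:R^-1) ->
  (forall i : {ffun 'I_H * S * A -> 'I_t.+1},
     exponent I Y' y' (grid_tilt i) t 0 w <= L) ->
  \sum_(x : 'I_H * S * A) N x.1.1 x.1.2 x.2 *
     (centered_sum Y y x.1.1 x.1.2 x.2 / N x.1.1 x.1.2 x.2) ^+ 2
    <= 4 * (L + H%:R).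
Proof.
move=> Y1 YY' gridL.
have N0 h s a : 0 <= N h s a by exact: ler0n.
have csle (h : 'I_H) s a : `|centered_sum Y y h s a| <= N h s a.
  by rewrite -[leRHS]mulr1; apply: centered_sum_le => k _; exact: Y1.
apply: (@quadratic_le_of_grid R ('I_H * S * A)%type t H
  (fun x => N x.1.1 x.1.2 x.2)
  (fun x => centered_sum Y y x.1.1 x.1.2 x.2 / N x.1.1 x.1.2 x.2)
  (fun x => centered_sum Y' y' x.1.1 x.1.2 x.2)) => [x||x|x|i].
- exact: N0.
- by rewrite sum_visits.
- rewrite normrM normfV [X in _ / X]ger0_norm//.
  have [->|Nx] := eqVneq (N x.1.1 x.1.2 x.2) 0; first by rewrite invr0 mulr0.
  by rewrite ler_pdivrMr ?mul1r// lt0r Nx N0.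
(* At an unvisited triplet the centered sum is 0 as well, so the conventional value of the quotient
   does no harm. *)
- have -> : N x.1.1 x.1.2 x.2 *
      (centered_sum Y y x.1.1 x.1.2 x.2 / N x.1.1 x.1.2 x.2) =
      centered_sum Y y x.1.1 x.1.2 x.2.
    have [Nx|Nx] := eqVneq (N x.1.1 x.1.2 x.2) 0.
      have := csle x.1.1 x.1.2 x.2; rewrite Nx mul0r normr_le0.
      by move=> /eqP ->.
    by rewrite mulrC divfK.
  rewrite /centered_sum -sumrB.
  rewrite visitsE mulr_suml; apply: (le_trans (ler_norm_sum _ _ _)).
  by apply: ler_sum => k _; rewrite mul1r YY'.
- have := gridL i; rewrite exponent_triplets.
  congr (_ <= _); apply: eq_bigr => -[[h s] a] _.
  by rewrite /grid_tilt /= on_stagesE.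
Qed.

Lemma centered_sumE (Y : nat -> nat -> T -> R) (y : nat -> S -> A -> R)
    (h : nat) (s : S) (a : A) :
  centered_sum Y y h s a =
  \sum_(k < t | at_pair I k h s a w) Y k h w - y h s a * N h s a.
Proof. by rewrite /centered_sum sumrB visitsE mulr_sumr mulr1. Qed.

Lemma emp_trans_mean (v : S -> R) (h : nat) (s : S) (a : A) :
  \sum_s' emp_trans I t w h s a s' * v s' =
  (\sum_(k < t | at_pair I k h s a w) v (state I k h.+1 w)) / N h s a.
Proof.
under eq_bigr do rewrite /emp_trans natr_sum mulrAC mulr_suml.
rewrite -mulr_suml; congr (_ / _).
rewrite exchange_big [RHS]big_mkcond/=; apply: eq_bigr => k _.
case: at_pair => /=; last by rewrite big1// => s' _; rewrite mul0r.
rewrite (bigD1 (state I k h.+1 w))//= eqxx mul1r big1 ?addr0// => s'.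
by rewrite eq_sym => /negbTE ->; rewrite mul0r.
Qed.

Lemma transition_deviation (v : nat -> S -> R) (h : nat) (s : S) (a : A) :
  0 < N h s a ->
  \sum_s' (emp_trans I t w h s a s' - trans M h s a s') * v h s' =
  centered_sum (fun k h w => v h (state I k h.+1 w))
    (fun h s a => \sum_s' trans M h s a s' * v h s') h s a / N h s a.
Proof.
move=> N0; under eq_bigr do rewrite mulrBl.
by rewrite sumrB emp_trans_mean centered_sumE mulrBl mulfK// gt_eqF.
Qed.

Lemma reward_deviation (h : nat) (s : S) (a : A) : 0 < N h s a ->
  emp_reward I t w h s a - mean_reward M h s a =
  centered_sum (reward I) (mean_reward M) h s a / N h s a.
Proof. by move=> N0; rewrite centered_sumE mulrBl mulfK// gt_eqF. Qed.

Lemma emp_trans_distr (h : nat) (s : S) (a : A) : 0 < N h s a ->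
  is_distr (emp_trans I t w h s a).
Proof.
move=> N0; split=> [s'|]; first by rewrite divr_ge0.
under eq_bigr do rewrite -[emp_trans _ _ _ _ _ _ _]mulr1.
by rewrite (emp_trans_mean (fun=> 1)) -visitsE divff// gt_eqF.
Qed.

Lemma emp_reward_range (h : nat) (s : S) (a : A) : 0 < N h s a ->
  (forall k, 0 <= reward I k h w <= 1) -> 0 <= emp_reward I t w h s a <= 1.
Proof.
move=> N0 r01; rewrite /emp_reward; apply/andP; split.
  apply: divr_ge0; last exact: ltW.
  by apply: sumr_ge0 => k _; have /andP[] := r01 k.
rewrite ler_pdivrMr// mul1r visitsE; apply: ler_sum => k _.
by have /andP[] := r01 k.
Qed.

End Deviations.

Lemma norm_sub_le_range (R : realDomainType) (c x y : R) :
  0 <= x <= c -> 0 <= y <= c -> `|x - y| <= c.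
Proof.
move=> /andP[x0 xc] /andP[y0 yc]; rewrite ler_norml.
by apply/andP; split; lra.
Qed.

Lemma grid_value_approx (R : realType) (S : finType) (H t : nat)
    (v : nat -> S -> R) : (forall h s, 0 <= v h s <= 1) ->
  exists j : {ffun 'I_H * S -> 'I_t.+1}, forall h s, (h < H)%N ->
    0 <= v h s - grid_value j h s <= t.+1%:R^-1.
Proof.
move=> v01.
have /choice[j jP] (x : 'I_H * S) :
    exists i : 'I_t.+1, 0 <= v x.1 x.2 - i%:R / t.+1%:R <= t.+1%:R^-1.
  exact: unit_grid.
exists [ffun x => j x] => h s hH.
have := jP (Ordinal hH, s); rewrite /grid_value.
by rewrite -[X in on_stages _ X]/(nat_of_ord (Ordinal hH)) on_stagesE ffunE.
Qed.

Lemma ln_succ_ge_half (R : realType) (t : nat) : (0 < t)%N ->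
  2^-1 <= ln (1 + t%:R) :> R.
Proof.
move=> t0; rewrite -ler_expR lnK ?posrE ?ltr_pwDl//.
apply: (@le_trans _ _ 2); last by rewrite -[2]/(1 + 1) lerD2l ler1n.
apply: (le_trans (expR_le_quadratic _)); lra.
Qed.

(** Origin of 24 = 8 + 8 + 8, with l the logarithm: 4(2n + 2) l is at most (8 + 8) n l, and 4H <= 4n
    <= 8 n l because l >= 1/2. *)
Lemma log_level_le (R : realType) (H n t : nat) (delta : R) :
  (0 < t)%N -> (0 < H)%N -> (H <= n)%N ->
  4 * (log_level n delta t + H%:R) <=
    4 * ln (2 / delta) + 24 * n%:R * ln (1 + t%:R).
Proof.
move=> t0 H0 Hn; rewrite /log_level.
have := ln_succ_ge_half R t0; set l := ln (1 + t%:R) => l_ge.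
have n1 : 1 <= n%:R :> R by rewrite ler1n (leq_trans H0).
have HnR : H%:R <= n%:R :> R by rewrite ler_nat.
have -> : (2 * n.+1)%:R = 2 * n%:R + 2 :> R.
  by rewrite natrM -[n.+1]addn1 natrD mulrDr mulr1.
set m := n%:R in n1 HnR *; set z := H%:R in HnR *.
have : l * 1 <= l * m by rewrite ler_wpM2l//; lra.
have : m * 2^-1 <= m * l by rewrite ler_wpM2l//; lra.
rewrite mulrDr; lra.
Qed.

(** * Deviation bounds on the good event *)

Section Concentration.
Context (d : measure_display) (T : measurableType d) (R : realType)
  (P : probability T R) (S A : finType) (H : nat) (M : mdp R S A H)
  (I : interaction P M).

Lemma covered_le (t u : nat) (w : T) : (t <= u)%N ->
  covered I t w -> covered I u w.
Proof.
move=> tu cov h s a hH ss; apply: leq_trans (cov h s a hH ss) _.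
by rewrite /visits -(subnKC tu) big_split_ord/= leq_addr.
Qed.

(** Coverage persists, so if it fails at [t], every covering time is an integer at least [t.+1], and
    so is the infimum bounded below, even when it is +oo. *)
Lemma cover_time_covered (t : nat) (w : T) :
  (cover_time I w <= t%:R%:E)%E -> covered I t w.
Proof.
move=> le_t; apply: contrapT => ncov.
suff : (t.+1%:R%:E <= cover_time I w)%E.
  by move=> /le_trans/(_ le_t); rewrite lee_fin ler_nat ltnn.
apply: le_ereal_inf_tmp => _ [u cov <-].
rewrite lee_fin ler_nat ltnNge; apply/negP => ut; apply: ncov.
exact: covered_le cov.
Qed.

Variables (t : nat) (w : T) (L : R).
Hypothesis rewardP : forall k h, (h < H)%N -> 0 <= reward I k h w <= 1 /\
  0 <= mean_reward M h (state I k h w) (action I k h w) <= 1.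
Hypothesis gridP : forall j i, @grid_exponent _ _ _ _ _ _ _ _ I t j i w <= L.
Hypothesis coveredP : covered I t w.

Local Notation N h s a := ((visits I t h s a w)%:R : R).

Lemma visits_gt0 (h : nat) (s : S) (a : A) :
  (h < H)%N -> stage_state (init M) h s -> 0 < N h s a.
Proof. by move=> hH ss; rewrite ltr0n; exact: coveredP. Qed.

Lemma stage_state_gt0 (h : nat) (s : S) : (0 < h)%N -> stage_state (init M) h s.
Proof. by case: h. Qed.

(** Coverage provides an episode that visits the triplet, and the good event bounds the mean reward
    along that episode. *)
Lemma mean_reward_range (h : nat) (s : S) (a : A) :
  (0 < h < H)%N -> 0 <= mean_reward M h s a <= 1.
Proof.
move=> /andP[h0 hH].
have := coveredP a hH (stage_state_gt0 s h0).
rewrite /visits lt0n sum_nat_eq0 => /forallPn[k].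
rewrite negb_imply/= eqb0 negbK.
by move=> /andP[/eqP <- /eqP <-]; have [] := rewardP k hH.
Qed.

Lemma transition_quadratic_le (v : nat -> S -> R) :
  (forall h s, 0 <= v h s <= 1) ->
  triplet_sum H (init M) (fun h s a => N h s a *
    (\sum_s' (emp_trans I t w h s a s' - trans M h s a s') * v h s') ^+ 2)
  <= 4 * (L + H%:R).
Proof.
move=> v01; have [j jP] := grid_value_approx H t v01.
pose y h s a := \sum_s' trans M h s a s' * v h s'.
have y01 h s a : (h < H)%N -> 0 <= y h s a <= 1.
  by move=> hH; apply: distr_mean_range => //; exact: trans_distr.
have dev1 k h s a : (h < H)%N -> `|v h (state I k h.+1 w) - y h s a| <= 1.
  by move=> hH; apply: norm_sub_le_range => //; exact: y01.
have mesh k h s a : (h < H)%N -> `|v h (state I k h.+1 w) - y h s a -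
    (outcome I (Some j) k h w - outcome_mean M (Some j) h s a)| <=
    t.+1%:R^-1.
  move=> hH.
  have -> : v h (state I k h.+1 w) - y h s a -
      (outcome I (Some j) k h w - outcome_mean M (Some j) h s a) =
      (v h (state I k h.+1 w) - grid_value j h (state I k h.+1 w)) -
      \sum_s' trans M h s a s' * (v h s' - grid_value j h s').
    rewrite /y /=; under [in RHS]eq_bigr do rewrite mulrBr.
    by rewrite sumrB; ring.
  (* The grid rounds downwards, so both errors lie in [0, 1/(t+1)] and their difference stays within
     one mesh, with no factor 2. *)
  apply: norm_sub_le_range; first exact: jP.
  apply: distr_mean_range => [|s']; first exact: trans_distr.
  exact: jP.
rewrite triplet_sumE.
apply: (le_trans _ (centered_sum_quadratic_le
  (Y := fun k h w => v h (state I k h.+1 w)) dev1 mesh (gridP (Some j)))).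
rewrite [leRHS](bigID (fun x : 'I_H * S * A =>
  stage_state (init M) x.1.1 x.1.2))/=.
rewrite -[leLHS]addr0; apply: lerD; last first.
  by apply: sumr_ge0 => x _; rewrite mulr_ge0 ?sqr_ge0 ?ler0n.
apply: ler_sum => -[[h s] a] /= ss.
by rewrite transition_deviation ?visits_gt0.
Qed.

Lemma reward_quadratic_le :
  triplet_sum H (init M) (fun h s a => N h s a *
    (emp_reward I t w h s a - mean_reward M h s a) ^+ 2) <= 4 * (L + H%:R).
Proof.
pose j : option {ffun 'I_H * S -> 'I_t.+1} := None.
have dev1 k h s a : (h < H)%N ->
    `|outcome I j k h w - outcome_mean M j h s a| <= 1.
  (* The reward is a single outcome: no rounding takes place, and the mesh condition below is
     trivial. *)
  by move=> _; apply: norm_sub_le_range; exact: clip_range.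
have mesh k h s a : (h < H)%N ->
    `|outcome I j k h w - outcome_mean M j h s a -
      (outcome I j k h w - outcome_mean M j h s a)| <= t.+1%:R^-1.
  by rewrite subrr normr0 invr_ge0.
rewrite triplet_sumE.
apply: (le_trans _ (centered_sum_quadratic_le dev1 mesh (gridP j))).
rewrite [leRHS](bigID (fun x : 'I_H * S * A =>
  stage_state (init M) x.1.1 x.1.2))/=.
rewrite -[leLHS]addr0; apply: lerD; last first.
  by apply: sumr_ge0 => x _; rewrite mulr_ge0 ?sqr_ge0 ?ler0n.
apply: ler_sum => -[[h s] a] /= ss.
rewrite reward_deviation ?visits_gt0// /centered_sum.
rewrite le_eqVlt; apply/orP; left; apply/eqP; congr (_ * (_ / _) ^+ 2).
apply: eq_bigr => k /andP[/eqP <- /eqP <-] /=.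
by have [? ?] := rewardP k (ltn_ord h); rewrite !clip_id.
Qed.

End Concentration.

Theorem theorem28 (d : measure_display) (T : measurableType d) (R : realType)
    (P : probability T R) (S A : finType) (H : nat) (M : mdp R S A H)
    (I : interaction P M) (delta : R) (hdelta : 0 < delta < 1) :
  exists E : set T,
    [/\ measurable E, ((1 - delta)%:E <= P E)%E
      & forall w, E w ->
        forall (t : nat) (pi : nat -> S -> A -> R),
          (cover_time I w <= (t%:R)%:E)%E ->
          stochastic_policy H pi ->
          let n h s a : R := (visits I t h s a w)%:R in
          let p_pi := visit_prob (init M) (trans M) pi in
          let phat_pi := visit_prob (init M) (emp_trans I t w) pi in
          let V := value H (init M) (trans M) (mean_reward M) pi in
          let Vhat := value H (init M) (emp_trans I t w) (emp_reward I t w) pi in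
          `|Vhat - V| <=
            Num.sqrt (beta_bpi #|S| #|A| H t delta *
              Num.min
                (triplet_sum H (init M) (fun h s a => p_pi h s a ^+ 2 / n h s a))
                (triplet_sum H (init M)
                   (fun h s a => phat_pi h s a ^+ 2 / n h s a)))
          /\
          forall rtil : nat -> S -> A -> R,
            (forall h s a, (h < H)%N -> 0 <= rtil h s a <= 1) ->
            `|triplet_sum H (init M)
                (fun h s a => (phat_pi h s a - p_pi h s a) * rtil h s a)| <=
              Num.sqrt (beta_p #|S| #|A| H t delta *
                triplet_sum H (init M) (fun h s a => p_pi h s a ^+ 2 / n h s a))].
Proof.
have /andP[d0 d1] := hdelta.
have A0 : (0 < #|A|)%N by apply/card_gt0P; exists (action I 0 0 point).
have S0 : (0 < #|S|)%N by apply/card_gt0P; exists (init M).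
have [E [mE PE goodE]] := good_event I d0 A0.
exists E; split=> // w /goodE[rewardP gridP] t pi cov piP n p_pi phat_pi V Vhat.
(* With no stage, even t = 0 counts as covered, and all the sums are empty. *)
have [H0|H0] := posnP H.
  have sum0 f : triplet_sum H (init M) f = 0 :> R.
    rewrite triplet_sumE big1// => -[[[h hH] s] a] _.
    by exfalso; move: hH; rewrite H0.
  by split=> [|rtil _]; rewrite /V /Vhat /value !sum0 ?subrr normr0 sqrtr_ge0.
have {}cov := cover_time_covered cov.
have t0 : (0 < t)%N.
  rewrite lt0n; apply/negP => /eqP t0.
  have := cov 0%N (init M) (action I 0 0 point) H0 (eqxx _).
  by rewrite t0 /visits big_ord0.
pose m := (H * #|S| * #|A|)%N.
have Hm : (H <= m)%N by rewrite /m -mulnA leq_pmulr// muln_gt0 S0.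
pose C : R := 4 * ln (2 / delta) + 24 * m%:R * ln (1 + t%:R).
have LC := log_level_le delta t0 H0 Hm.
have n0 h s a : (h < H)%N -> stage_state (init M) h s -> 0 < n h s a.
  exact: visits_gt0.
have ss h s : (0 < h < H)%N -> stage_state (init M) h s by case: h.
have {}gridP j i := gridP t j i t0.
have vC (v : nat -> S -> R) (v01 : forall h s, 0 <= v h s <= 1) :=
  le_trans (transition_quadratic_le gridP cov v01) LC.
have rC := le_trans (reward_quadratic_le rewardP gridP cov) LC.
have betaE : beta_p #|S| #|A| H t delta = H%:R ^+ 2 * C.
  by rewrite /beta_p /C /m !natrM; ring.
have beta_bpiE : beta_bpi #|S| #|A| H t delta = 4 * (H%:R ^+ 2 * C).
  by rewrite /beta_bpi /C /m !natrM; ring.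
have vC' v : (forall h s, 0 <= v h s <= 1) ->
    triplet_sum H (init M) (fun h s a => n h s a *
      (\sum_s' (trans M h s a s' - emp_trans I t w h s a s') * v h s') ^+ 2)
    <= C.
  move=> v01; apply: le_trans (vC v v01); rewrite !triplet_sumE.
  apply: ler_sum => x _; rewrite -[X in _ <= _ * X]sqrrN -sumrN.
  by under [X in _ <= _ * X ^+ 2]eq_bigr do rewrite -mulNr opprB.
have rC' : triplet_sum H (init M) (fun h s a => n h s a *
      (mean_reward M h s a - emp_reward I t w h s a) ^+ 2) <= C.
  apply: le_trans rC; rewrite !triplet_sumE.
  by apply: ler_sum => x _; rewrite -[X in _ <= _ * X]sqrrN opprB.
have empP h s a : (0 < h < H)%N -> is_distr (emp_trans I t w h s a).
  move=> hH; have /andP[_ hH'] := hH.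
  by apply: emp_trans_distr; apply: n0 => //; exact: ss.
have emp_rewP h s a : (0 < h < H)%N -> 0 <= emp_reward I t w h s a <= 1.
  move=> hH; have /andP[_ hH'] := hH.
  apply: emp_reward_range; first by apply: n0 => //; exact: ss.
  by move=> k; have [] := rewardP k h hH'.
have transP h s a : (0 < h < H)%N -> is_distr (trans M h s a).
  by move=> /andP[_]; exact: trans_distr.
have meanP h s a : (0 < h < H)%N -> 0 <= mean_reward M h s a <= 1.
  exact: (mean_reward_range rewardP cov).
split=> [|rtil rtil01].
  (* Each term of the minimum is one direction of the simulation lemma: the model that provides the
     visit probabilities is compared with the value function of the other. *)
  rewrite beta_bpiE /Num.min; case: ifP => _.
    rewrite distrC; exact: value_gap_le.
  exact: value_gap_le.
(* A gap between two values with the same reward function [rtil]: the reward part vanishes, and with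
   it the factor 4 between the two betas. *)
have -> : triplet_sum H (init M)
      (fun h s a => (phat_pi h s a - p_pi h s a) * rtil h s a) =
    - (value H (init M) (trans M) rtil pi -
       value H (init M) (emp_trans I t w) rtil pi).
  rewrite opprB /value !triplet_sumE -sumrB.
  by apply: eq_bigr => x _; rewrite mulrBl.
rewrite normrN simulation_identity betaE.
have := transition_gap_le piP empP (fun h s a hH => rtil01 h s a
  (proj2 (andP hH))) n0 vC'.
rewrite [X in `|X|]triplet_sumE [X in _ -> `|X| <= _]triplet_sumE.
by under [X in _ -> `|X| <= _]eq_bigr do rewrite subrr add0r.
Qed.
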